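(* There exist exactly $8$ isomorphism classes of (non-abelian) $2$-step nilpotent real Lie algebras of dimension $p\le 6$ admitting an inner product for which the corresponding simply connected Riemannian Lie group carries non-zero left-invariant Killing $3$-forms: - $p=3$: $\mathfrak h_3$; - $p=4$: $\mathbb R\oplus\mathfrak h_3$; - $p=5$: $\mathbb R^2\oplus\mathfrak h_3$ and $\mathfrak h_5$; - $p=6$: $\mathbb R^3\oplus\mathfrak h_3$, $\mathfrak h_3\oplus\mathfrak h_3$, $\mathbb R\oplus\mathfrak h_5$, $\mathfrak n_{3,2}$.
   Context: A real finite-dimensional Lie algebra is $2$-step nilpotent if it is non-abelian and its commutator is contained in its center. $\mathfrak h_{2l+1}$ is the real Heisenberg Lie algebra of dimension $2l+1$, $\mathbb R^k$ the abelian Lie algebra of dimension $k$, and $\mathfrak n_{3,2}$ the free $2$-step nilpotent Lie algebra on $3$ generators, which has a basis $e_1,\dots,e_6$ with non-zero brackets $[e_1,e_2]=e_4$, $[e_1,e_3]=e_5$, $[e_2,e_3]=e_6$. Given an inner product on a Lie algebra $\mathfrak n$, the corresponding simply connected Riemannian Lie group is the simply connected Lie group $N$ with Lie algebra $\mathfrak n$, with the induced left-invariant Riemannian metric $g$. A Killing $k$-form on a Riemannian manifold is a differential $k$-form $\alpha$ with $\nabla_Y\alpha=\frac1{k+1}\,Y\lrcorner\, d\alpha$ for every vector field $Y$ ($\nabla$ the Levi-Civita connection, $\lrcorner$ contraction). A form is left-invariant if it is preserved by all left translations. *)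

(* Defs.v *)
From HB Require Import structures.
From mathcomp Require Import all_boot all_order all_algebra sesquilinear.
From mathcomp Require Import ring.
From mathcomp Require Import all_classical all_reals all_analysis.

Set Implicit Arguments.
Unset Strict Implicit.
Unset Printing Implicit Defensive.
Import Order.TTheory GRing.Theory Num.Theory.
Import numFieldNormedType.Exports.
Local Open Scope ring_scope.

(* A real Lie algebra of dimension p is given in a basis, i.e. as a Lie
   bracket on R^p. *)
Record lie_algebra (R : realType) := LieAlgebra {
  lie_dim : nat;
  lie_br : {bilinear 'rV[R]_lie_dim -> 'rV[R]_lie_dim -> 'rV[R]_lie_dim};
  lie_alt : forall x, lie_br x x = 0;
  lie_jacobi : forall x y z,
    lie_br x (lie_br y z) + lie_br y (lie_br z x) + lie_br z (lie_br x y) = 0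
}.

Definition two_step_nilpotent (R : realType) (n : lie_algebra R) : Prop :=
  (exists x y, lie_br n x y != 0) /\
  (forall x y z, lie_br n (lie_br n x y) z = 0).

Definition lie_iso (R : realType) (n m : lie_algebra R) : Prop :=
  exists f : {linear 'rV[R]_(lie_dim n) -> 'rV[R]_(lie_dim m)},
    bijective f /\ forall x y, f (lie_br n x y) = lie_br m (f x) (f y).

Section Models.
Variable R : realType.

Definition bilinear_of p (br : 'rV[R]_p -> 'rV[R]_p -> 'rV[R]_p)
    (br_bil : bilinear_for *:%R *:%R br) :
    {bilinear 'rV[R]_p -> 'rV[R]_p -> 'rV[R]_p} :=
  HB.pack br (bilinear_isBilinear.Build R _ _ _ _ _ br br_bil).

Definition abelian_br k (x y : 'rV[R]_k) : 'rV[R]_k := 0.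

Fact abelian_bil k : bilinear_for *:%R *:%R (@abelian_br k).
Proof. by split=> u a x y; rewrite /= /abelian_br scaler0 addr0. Qed.

Fact abelian_alt k x : @abelian_br k x x = 0.
Proof. by []. Qed.

Fact abelian_jacobi k x y z :
  @abelian_br k x (abelian_br y z) + abelian_br y (abelian_br z x)
  + abelian_br z (abelian_br x y) = 0.
Proof. by rewrite /abelian_br !addr0. Qed.

Definition abelian k : lie_algebra R :=
  @LieAlgebra R k (bilinear_of (@abelian_bil k))
    (@abelian_alt k) (@abelian_jacobi k).

(* On R^l + R^l + R : [(a, b, c), (a', b', c')] = (0, 0, a.b' - a'.b). *)
Definition heisenberg_br l (x y : 'rV[R]_(l + l + 1)) : 'rV[R]_(l + l + 1) :=
  row_mx 0 (lsubmx (lsubmx x) *m (rsubmx (lsubmx y))^T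
            - lsubmx (lsubmx y) *m (rsubmx (lsubmx x))^T).

Fact heisenberg_bil l : bilinear_for *:%R *:%R (@heisenberg_br l).
Proof.
split=> u a x y;
  rewrite /= /heisenberg_br scale_row_mx add_row_mx scaler0 addr0; congr row_mx;
  rewrite !(linearD, linearZ) /= ?mulmxDl ?mulmxDr -?scalemxAl -?scalemxAr.
  exact: addrACA.
by rewrite opprD addrACA scalerN.
Qed.

Fact heisenberg_alt l x : @heisenberg_br l x x = 0.
Proof. by rewrite /heisenberg_br subrr row_mx0. Qed.

Fact heisenberg_jacobi l x y z :
  @heisenberg_br l x (heisenberg_br y z) + heisenberg_br y (heisenberg_br z x)
  + heisenberg_br z (heisenberg_br x y) = 0.
Proof.
have H u v w : @heisenberg_br l u (heisenberg_br v w) = 0.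
  by rewrite /heisenberg_br !row_mxKl !(linear0, mul0mx, subr0) row_mx0.
by rewrite !H !addr0.
Qed.

Definition heisenberg l : lie_algebra R :=
  @LieAlgebra R (l + l + 1) (bilinear_of (@heisenberg_bil l))
    (@heisenberg_alt l) (@heisenberg_jacobi l).

(* The non-zero brackets of basis vectors, up to antisymmetry, are
   [e_0, e_1] = e_3, [e_0, e_2] = e_4 and [e_1, e_2] = e_5. *)
Definition n32_br (x y : 'rV[R]_6) : 'rV[R]_6 :=
  let minor i j := x 0 (inord i) * y 0 (inord j) - x 0 (inord j) * y 0 (inord i) in
  minor 0%N 1%N *: delta_mx 0 (inord 3) + minor 0%N 2%N *: delta_mx 0 (inord 4)
  + minor 1%N 2%N *: delta_mx 0 (inord 5).

Fact n32_bil : bilinear_for *:%R *:%R n32_br.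
Proof.
by split=> u a x y; apply/rowP=> k; rewrite /n32_br !mxE; ring.
Qed.

Fact n32_alt x : n32_br x x = 0.
Proof. by apply/rowP=> k; rewrite /n32_br !mxE; ring. Qed.

Fact n32_jacobi x y z :
  n32_br x (n32_br y z) + n32_br y (n32_br z x) + n32_br z (n32_br x y) = 0.
Proof.
have n32_low u v i : (i < 3)%N -> n32_br u v 0 (inord i) = 0.
  move=> i3; rewrite /n32_br !mxE -!val_eqE /= !inordK //; last exact: ltn_trans i3 _.
  by case: i i3 => [|[|[|]]] //= _; rewrite !mulr0 !addr0.
have n32_2 u v w : n32_br u (n32_br v w) = 0.
  by rewrite {1}/n32_br !n32_low // !mulr0 subrr !scale0r !addr0.
by rewrite !n32_2 !addr0.
Qed.

Definition free_two_step_3 : lie_algebra R :=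
  @LieAlgebra R 6 (bilinear_of n32_bil) n32_alt n32_jacobi.

Section DirectSum.
Variables n m : lie_algebra R.
Local Notation V := 'rV[R]_(lie_dim n + lie_dim m).

Definition dsum_br (x y : V) : V :=
  row_mx (lie_br n (lsubmx x) (lsubmx y)) (lie_br m (rsubmx x) (rsubmx y)).

Fact dsum_bil : bilinear_for *:%R *:%R dsum_br.
Proof.
split=> u a x y; rewrite /= /dsum_br scale_row_mx add_row_mx !linearP //=.
by rewrite !linearPl.
Qed.

Fact dsum_alt x : dsum_br x x = 0.
Proof. by rewrite /dsum_br !lie_alt row_mx0. Qed.

Fact dsum_jacobi x y z :
  dsum_br x (dsum_br y z) + dsum_br y (dsum_br z x) + dsum_br z (dsum_br x y)
  = 0.
Proof.
by rewrite /dsum_br !row_mxKl !row_mxKr !add_row_mx !lie_jacobi row_mx0.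
Qed.

Definition lie_dsum : lie_algebra R :=
  @LieAlgebra R _ (bilinear_of dsum_bil) dsum_alt dsum_jacobi.

End DirectSum.
End Models.

(* Differential geometry on the manifold R^p, in its global chart: tangent
   vectors at any point are elements of R^p. *)
Section Geometry.
Variables (R : realType) (p : nat).
Local Notation V := 'rV[R]_p.

Definition smooth (W : normedModType R) (f : V -> W) : Prop :=
  forall (s : seq V) (x : V), differentiable (foldr (fun v h => 'D_v h) f s) x.

(* A k-form alpha sends a point x and tangent vectors v_0, ..., v_(k-1) at x
   to alpha x v. *)
Definition differential_form k (alpha : V -> ('I_k -> V) -> R) : Prop :=
  [/\ forall x v i, scalar (fun u => alpha x [eta v with i |-> u]),
      forall x v i j, i != j -> v i = v j -> alpha x v = 0
    & forall v, smooth (fun x => alpha x v : R^o)].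

(* Both the exterior derivative and the covariant derivative of a form are
   evaluated on tangent vectors extended to constant vector fields; these
   commute, so the bracket terms of the exterior derivative vanish. *)
Definition exterior_derivative k (alpha : V -> ('I_k -> V) -> R)
    (x : V) (v : 'I_k.+1 -> V) : R :=
  \sum_(i < k.+1)
    (-1) ^+ i * 'D_(v i) (fun z => alpha z (v \o lift i) : R^o) x.

Definition contraction k (beta : ('I_k.+1 -> V) -> R) (y : V)
    (v : 'I_k -> V) : R :=
  beta (fun i => if unlift ord0 i is Some j then v j else y).

(* Every affine connection on R^p is nabla Gamma for a unique field Gamma of
   bilinear maps, whose coefficients are the Christoffel symbols. *)
Definition connection := V -> {bilinear V -> V -> V}.

Definition nabla (Gamma : connection) (X Y : V -> V) (x : V) : V :=
  'D_(X x) Y x + Gamma x (X x) (Y x).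

Definition nabla_form (Gamma : connection) k (alpha : V -> ('I_k -> V) -> R)
    (Y : V -> V) (x : V) (v : 'I_k -> V) : R :=
  'D_(Y x) (fun z => alpha z v : R^o) x
  - \sum_(i < k) alpha x [eta v with i |-> nabla Gamma Y (fun=> v i) x].

Definition vf_bracket (X Y : V -> V) (x : V) : V := 'D_(X x) Y x - 'D_(Y x) X x.

(* These conditions determine Gamma, which is therefore smooth if g is. *)
Definition levi_civita (g : V -> V -> V -> R) (Gamma : connection) : Prop :=
  forall X Y Z : V -> V, smooth X -> smooth Y -> smooth Z -> forall x,
    nabla Gamma X Y x - nabla Gamma Y X x = vf_bracket X Y x /\
    'D_(X x) (fun z => g z (Y z) (Z z) : R^o) x
    = g x (nabla Gamma X Y x) (Z x) + g x (Y x) (nabla Gamma X Z x).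

Definition killing_form (g : V -> V -> V -> R) k
    (alpha : V -> ('I_k -> V) -> R) : Prop :=
  differential_form alpha /\
  exists Gamma, levi_civita g Gamma /\
    forall Y, smooth Y -> forall x v,
      nabla_form Gamma alpha Y x v
      = (k.+1%:R)^-1 * contraction (exterior_derivative alpha x) (Y x) v.

End Geometry.

(* For a 2-step nilpotent Lie algebra n, the simply connected Lie group with
   Lie algebra n is, through its exponential map, the manifold n itself with
   the product given by the Baker-Campbell-Hausdorff formula, which stops after
   the first bracket; the unit is 0 and the inverse of a is - a. That the Lie
   algebra of this group is n is left_invariant_field_bracket below. *)
Section Group.
Variables (R : realType) (n : lie_algebra R).
Local Notation V := 'rV[R]_(lie_dim n).

Definition group_mul (a x : V) : V := a + x + 2^-1 *: lie_br n a x.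

Fact lie_antisym u v : lie_br n u v = - lie_br n v u.
Proof.
apply/eqP; rewrite -addr_eq0; apply/eqP.
by have := lie_alt (u + v); rewrite linearDl !linearDr !lie_alt add0r addr0.
Qed.

Fact group_mulA : two_step_nilpotent n -> associative group_mul.
Proof.
case=> _ n2 a b c; rewrite /group_mul.
have n2r x y z : lie_br n x (lie_br n y z) = 0.
  by rewrite lie_antisym n2 oppr0.
rewrite !(linearDl, linearDr) /= !(linearZl_LR, linearZr_LR) /= n2 n2r.
rewrite !scaler0 !addr0 !scalerDr -!addrA.
congr (_ + (_ + _)); rewrite [RHS]addrCA; congr (_ + _).
by rewrite addrC -addrA.
Qed.

Lemma rV_linear_continuous p (W : normedModType R)
  (f : {linear 'rV[R]_p -> W}) : continuous f.
Proof.
have -> : (f : _ -> _) = fun x => \sum_j x 0 j *: f (delta_mx 0 j).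
  apply/funext=> x; rewrite {1}[x]row_sum_delta linear_sum.
  by apply: eq_bigr => j _; rewrite linearZ.
apply: continuous_big => [|j _ x]; first exact: add_continuous.
by apply: cvgZr_tmp; [exact: nbhs_filter | exact: coord_continuous].
Qed.

Fact is_diff_lie_br a x : is_diff x (lie_br n a) (lie_br n a).
Proof.
have cont := @rV_linear_continuous _ _ (lie_br n a).
by apply: DiffDef; [exact: linear_differentiable | exact: diff_lin].
Qed.

Fact diff_group_mul a x v : 'd (group_mul a) x v = v + 2^-1 *: lie_br n a v.
Proof.
have ? := is_diff_lie_br a x.
suff H : is_diff x (group_mul a) (fun v => v + 2^-1 *: lie_br n a v).
  by rewrite diff_val.
have -> : group_mul a = (cst a + id) + 2^-1 \*: lie_br n a by [].
by apply: is_diff_eq; rewrite add0r.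
Qed.

(* The left-invariant vector field with value u at the unit. *)
Definition left_invariant_field (u x : V) : V := 'd (group_mul x) 0 u.

Fact left_invariant_field_bracket : two_step_nilpotent n -> forall u v,
  vf_bracket (left_invariant_field u) (left_invariant_field v)
  = left_invariant_field (lie_br n u v).
Proof.
move=> [_ n2] u v.
have D w z x : 'D_w (left_invariant_field z) x = 2^-1 *: lie_br n w z.
  have ? := is_diff_lie_br z x.
  have fE : left_invariant_field z = cst z + (- 2^-1) \*: lie_br n z.
    apply/funext => y; rewrite /left_invariant_field diff_group_mul.
    by rewrite lie_antisym scalerN -scaleNr.
  have H : is_diff x (left_invariant_field z) ((- 2^-1) \*: lie_br n z).
    by rewrite fE; apply: is_diff_eq; rewrite add0r.
  by rewrite deriveE // diff_val /= lie_antisym scalerN scaleNr opprK.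
apply/funext=> x; rewrite /vf_bracket !D /left_invariant_field.
rewrite !diff_group_mul !(linearDl, linearZl_LR) /= !n2.
rewrite (lie_antisym x) n2 (lie_antisym v) !(oppr0, scaler0, addr0) scalerN opprK.
rewrite -scalerDl; have -> : 2^-1 + 2^-1 = 1 :> R by field.
exact: scale1r.
Qed.

Definition left_invariant_metric (ip : {dot V for idfun}) (x u v : V) : R :=
  ip ('d (group_mul (- x)) x u) ('d (group_mul (- x)) x v).

Definition left_invariant_form k (alpha : V -> ('I_k -> V) -> R) : Prop :=
  forall a x v,
    alpha (group_mul a x) (fun i => 'd (group_mul a) x (v i)) = alpha x v.

Definition carries_left_invariant_killing_form k (ip : {dot V for idfun}) :
    Prop :=
  exists alpha : V -> ('I_k -> V) -> R,
    [/\ killing_form (left_invariant_metric ip) alpha,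
        left_invariant_form alpha & exists x v, alpha x v != 0].

End Group.

(* Main.v *)
Require Import Defs.
From HB Require Import structures.
From mathcomp Require Import all_boot all_order all_algebra sesquilinear.
From mathcomp Require Import zify ring lra complex.
From mathcomp Require Import all_classical all_reals all_analysis.

Set Implicit Arguments.
Unset Strict Implicit.
Unset Printing Implicit Defensive.
Import Order.TTheory GRing.Theory Num.Theory.
Import numFieldNormedType.Exports.
Local Open Scope classical_set_scope.
Local Open Scope ring_scope.

(** A left-invariant form is determined by its value a at the unit, and the
    Levi-Civita connection of a left-invariant metric by the bilinear product nab
    that it induces on the Lie algebra: nab u v - nab v u is the bracket and each
    nab u is skew. A form alpha is Killing exactly if the contraction of Y with
    nabla_Y alpha vanishes for all Y. Hence the group carries a non-zero
    left-invariant Killing 3-form if and only if there is a non-zero alternating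
    a with
      a (nab y y) u w + a y (nab y u) w + a y u (nab y w) = 0
    (left_invariant_killing_algebra, killing_algebra_left_invariant), and the
    theorem becomes a statement of linear algebra.

    For existence, let eta be dual to the central direction of a Heisenberg
    algebra; then the wedge product of eta with its differential is Killing
    (contact_killing3), and it pulls back to any direct sum (lie_dsum_killing3).
    The free algebra on three generators has a form of its own
    (free_two_step_3_killing3).

    For the classification, let D be the derived algebra. If D is a line, the
    bracket is a scalar 2-form and a Darboux basis gives an abelian summand plus
    a Heisenberg algebra (lie_iso_heisenberg_sum). If D has dimension at least
    three, then at most three generators remain in dimension six, and the
    brackets of three generators must be independent
    (lie_iso_free_two_step_3).

    Suppose that D is a plane, and let V be its orthogonal complement, of
    dimension at most four. The brackets are given by skew maps J_z of V, for z in
    D. The part of a with one argument in D gives skew maps S_z that commute with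
    all J_z; the part with two arguments in D is a vector xi of V, and the part
    with none is a 3-form on V, which vanishes if the other parts do
    (horizontal_form_eq0). If some S_z or xi is non-zero, there is a non-zero
    singular skew map of V whose row space is stable under all J_z
    (split_of_S1, split_of_S2, split_of_xi); the delicate subcase, where all J_z
    commute, uses an eigenvalue of the symmetric map J_1^-1 J_2
    (split_of_commuting). Such a map has rank two, its row space and
    its kernel are commuting planes (split_of_singular), and the algebra is the sum
    of two three-dimensional Heisenberg algebras.

    The models of equal dimension are separated by two invariants: whether the
    derived algebra is a line, and whether all 2-forms obtained by composing the
    bracket with a linear form are decomposable. *)

(** * Derivatives of multilinear expressions *)

Definition linear_of (R : nzRingType) (U W : lmodType R) (f : U -> W)
    (f_lin : linear f) : {linear U -> W} :=
  HB.pack f (GRing.isLinear.Build _ _ _ _ f f_lin).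

Definition bilinear_map_of (R : nzRingType) (U U' W : lmodType R)
    (f : U -> U' -> W) (f_bil : bilinear_for *:%R *:%R f) :
    {bilinear U -> U' -> W} :=
  HB.pack f (bilinear_isBilinear.Build R _ _ _ _ _ f f_bil).

Section Derivatives.
Variables (R : realType) (p : nat).
Local Notation V := 'rV[R]_p.
Implicit Types (x v : V).

Lemma is_derive_linear (W W' : normedModType R) (L : {linear W -> W'})
    (f : V -> W) x v df :
  continuous L -> is_derive x v f df -> is_derive x v (L \o f) (L df).
Proof.
move=> Lcont [fd <-].
have H : (fun h : R => h^-1 *: ((L \o f) (h *: v + x) - (L \o f) x))
    @ 0^' --> L ('D_v f x).
  have -> : (fun h : R => h^-1 *: ((L \o f) (h *: v + x) - (L \o f) x))
      = L \o (fun h : R => h^-1 *: (f (h *: v + x) - f x)).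
    by apply/funext => h; rewrite /= linearZ_LR (raddfB L).
  exact: (cvg_comp _ _ fd (Lcont _)).
apply: DeriveDef; first by apply/cvg_ex; exists (L ('D_v f x)); exact: H.
exact/cvg_lim.
Qed.

Lemma is_derive_coord q (f : V -> 'rV[R]_q) x v df i j :
  is_derive x v f df -> is_derive x v (fun z => f z i j) (df i j).
Proof.
pose L : 'rV[R]_q -> R := fun M => M i j.
have Llin : linear L by move=> a M N; rewrite /L !mxE.
apply: (@is_derive_linear _ _ (linear_of Llin)); exact: coord_continuous.
Qed.

Lemma is_derive_scalel (W : normedModType R) (w : W) (f : V -> R) x v df :
  is_derive x v f df -> is_derive x v (fun z => f z *: w) (df *: w).
Proof.
pose L : R -> W := fun r => r *: w.
have Llin : linear L by move=> a M N; rewrite /L scalerDl scalerA.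
apply: (@is_derive_linear _ _ (linear_of Llin)); exact: scalel_continuous.
Qed.

Lemma bilinear_coord q r (W : lmodType R)
    (B : {bilinear 'rV[R]_q -> 'rV[R]_r -> W}) y z :
  B y z = \sum_i \sum_j (y 0 i * z 0 j) *: B (delta_mx 0 i) (delta_mx 0 j).
Proof.
rewrite {1}[y]row_sum_delta {1}[z]row_sum_delta linear_sumlz.
apply: eq_bigr => i _; rewrite linear_sumr; apply: eq_bigr => j _.
by rewrite linearZr_LR linearZl_LR scalerA mulrC.
Qed.

Lemma is_derive_bilinear q r (W : normedModType R)
    (B : {bilinear 'rV[R]_q -> 'rV[R]_r -> W}) f g x v df dg :
  is_derive x v f df -> is_derive x v g dg ->
  is_derive x v (fun z => B (f z) (g z)) (B df (g x) + B (f x) dg).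
Proof.
move=> Df Dg.
have -> : (fun z => B (f z) (g z)) = \sum_i \sum_j
    (fun z => (f z 0 i * g z 0 j) *: B (delta_mx 0 i) (delta_mx 0 j)).
  apply/funext => z; rewrite bilinear_coord fct_sumE.
  by apply: eq_bigr => i _; rewrite fct_sumE.
have H i j := is_derive_scalel (B (delta_mx 0 i) (delta_mx 0 j))
  (is_deriveM (is_derive_coord 0 i Df) (is_derive_coord 0 j Dg)).
have H1 i := is_derive_sum (H i).
have H2 := is_derive_sum H1.
apply: (is_derive_eq H2).
rewrite (bilinear_coord _ df) (bilinear_coord _ (f x)) -big_split /=.
apply: eq_bigr => i _; rewrite -big_split /=; apply: eq_bigr => j _.
rewrite -scalerDl; congr (_ *: _); rewrite addrC; congr (_ + _).
by rewrite /GRing.scale /= mulrC.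
Qed.

End Derivatives.

(** * Alternating 3-forms and inner products *)

Definition alternating3 (R : nzRingType) (V : lmodType R)
    (a : V -> V -> V -> R) : Prop :=
  [/\ forall y z, scalar (fun x => a x y z),
      forall x y z, a x y z = a y z x
    & forall x z, a x x z = 0].

Section Alternating3.
Variables (R : nzRingType) (V : lmodType R) (a : V -> V -> V -> R).
Hypothesis altA : alternating3 a.
Implicit Types x y z : V.

Lemma alt3_rot x y z : a x y z = a y z x.
Proof. by case: altA. Qed.

Lemma alt3P1 c x x' y z : a (c *: x + x') y z = c * a x y z + a x' y z.
Proof. by case: altA => L _ _; exact: (L y z c x x'). Qed.

Lemma alt3D1 x x' y z : a (x + x') y z = a x y z + a x' y z.
Proof. by rewrite -[x]scale1r alt3P1 mul1r scale1r. Qed.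

Lemma alt3_01 y z : a 0 y z = 0.
Proof. by apply: (@addrI _ (a 0 y z)); rewrite -alt3D1 !addr0. Qed.

Lemma alt3Z1 c x y z : a (c *: x) y z = c * a x y z.
Proof. by rewrite -[c *: x]addr0 alt3P1 alt3_01 addr0. Qed.

Lemma alt3N1 x y z : a (- x) y z = - a x y z.
Proof. by rewrite -scaleN1r alt3Z1 mulN1r. Qed.

Lemma alt3P2 c x x' y z : a y (c *: x + x') z = c * a y x z + a y x' z.
Proof. by rewrite alt3_rot alt3P1 -(alt3_rot y x) -(alt3_rot y x'). Qed.

Lemma alt3D2 x x' y z : a y (x + x') z = a y x z + a y x' z.
Proof. by rewrite alt3_rot alt3D1 -(alt3_rot y x) -(alt3_rot y x'). Qed.

Lemma alt3Z2 c x y z : a y (c *: x) z = c * a y x z.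
Proof. by rewrite alt3_rot alt3Z1 -(alt3_rot y x). Qed.

Lemma alt3N2 x y z : a y (- x) z = - a y x z.
Proof. by rewrite -scaleN1r alt3Z2 mulN1r. Qed.

Lemma alt3P3 c x x' y z : a y z (c *: x + x') = c * a y z x + a y z x'.
Proof. by rewrite -alt3_rot alt3P1 !(alt3_rot _ y z). Qed.

Lemma alt3D3 x x' y z : a y z (x + x') = a y z x + a y z x'.
Proof. by rewrite -alt3_rot alt3D1 !(alt3_rot _ y z). Qed.

Lemma alt3_03 y z : a y z 0 = 0.
Proof. by rewrite -alt3_rot alt3_01. Qed.

Lemma alt3Z3 c x y z : a y z (c *: x) = c * a y z x.
Proof. by rewrite -alt3_rot alt3Z1 !(alt3_rot _ y z). Qed.

Lemma alt3N3 x y z : a y z (- x) = - a y z x.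
Proof. by rewrite -scaleN1r alt3Z3 mulN1r. Qed.

Lemma alt3_eq12 x z : a x x z = 0.
Proof. by case: altA. Qed.

Lemma alt3_eq23 x z : a z x x = 0.
Proof. by rewrite alt3_rot alt3_eq12. Qed.

Lemma alt3_eq13 x z : a x z x = 0.
Proof. by rewrite alt3_rot alt3_eq23. Qed.

Lemma alt3_swap12 x y z : a x y z = - a y x z.
Proof.
apply/eqP; rewrite -addr_eq0; apply/eqP.
by have := alt3_eq12 (x + y) z; rewrite alt3D1 !alt3D2 !alt3_eq12 add0r addr0.
Qed.

Lemma alt3_swap23 x y z : a x y z = - a x z y.
Proof. by rewrite alt3_rot alt3_swap12 -alt3_rot. Qed.

Lemma alt3_swap13 x y z : a x y z = - a z y x.
Proof. by rewrite alt3_rot alt3_swap23 -alt3_rot. Qed.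

End Alternating3.

Section DotProduct.
Variables (R : realType) (p : nat) (ip : {dot 'rV[R]_p for idfun}).
Implicit Types u v w : 'rV[R]_p.

Lemma dotC u v : ip u v = ip v u.
Proof. by have := @hermitian_subproof _ _ _ _ ip u v; rewrite expr0 mul1r. Qed.

Lemma dotDl u v w : ip (u + v) w = ip u w + ip v w.
Proof. exact: linearDl. Qed.

Lemma dotZl c u w : ip (c *: u) w = c * ip u w.
Proof. exact: linearZl_LR. Qed.

Lemma dotDr u v w : ip w (u + v) = ip w u + ip w v.
Proof. by rewrite dotC dotDl !(dotC w). Qed.

Lemma dotZr c u w : ip w (c *: u) = c * ip w u.
Proof. by rewrite dotC dotZl dotC. Qed.

Lemma dotNl u w : ip (- u) w = - ip u w.
Proof. by rewrite -scaleN1r dotZl mulN1r. Qed.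

Lemma dotNr u w : ip w (- u) = - ip w u.
Proof. by rewrite -scaleN1r dotZr mulN1r. Qed.

Lemma dotBl u v w : ip (u - v) w = ip u w - ip v w.
Proof. by rewrite dotDl dotNl. Qed.

Lemma dotBr u v w : ip w (u - v) = ip w u - ip w v.
Proof. by rewrite dotDr dotNr. Qed.

Lemma dot0l w : ip 0 w = 0.
Proof. by rewrite -[0](scale0r 0) dotZl mul0r. Qed.

Lemma dot0r w : ip w 0 = 0.
Proof. by rewrite dotC dot0l. Qed.

Lemma dot_suml (I : finType) (F : I -> 'rV[R]_p) w :
  ip (\sum_i F i) w = \sum_i ip (F i) w.
Proof. exact: linear_sumlz. Qed.

Lemma dot_sumr (I : finType) (F : I -> 'rV[R]_p) w :
  ip w (\sum_i F i) = \sum_i ip w (F i).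
Proof. by rewrite dotC dot_suml; apply: eq_bigr => i _; exact: dotC. Qed.

Lemma dot_gt0 u : u != 0 -> 0 < ip u u.
Proof. exact: neq0_dnorm_gt0. Qed.

Lemma dot_eq0 u : ip u u = 0 -> u = 0.
Proof.
by move=> u0; apply/eqP; apply/negP => /negP /dot_gt0; rewrite u0 ltxx.
Qed.

Lemma dot_bilinear : bilinear_for *:%R *:%R (ip : 'rV[R]_p -> 'rV[R]_p -> R).
Proof.
split=> u a x y /=; rewrite ?dotDl ?dotZl ?dotDr ?dotZr;
  by rewrite /GRing.scale /= // mulrC.
Qed.

End DotProduct.

(** * The Killing equation on the Lie algebra *)

Definition levi_civita_product (R : realType) (n : lie_algebra R)
    (ip : 'rV[R]_(lie_dim n) -> 'rV[R]_(lie_dim n) -> R)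
    (nab : 'rV[R]_(lie_dim n) -> 'rV[R]_(lie_dim n) -> 'rV[R]_(lie_dim n)) :=
  (forall u v, nab u v - nab v u = lie_br n u v) /\
  (forall u v w, ip (nab u v) w + ip v (nab u w) = 0).

(** The equation is polynomial in y because a form is Killing exactly if the
    contraction of Y with its covariant derivative along Y vanishes for every
    left-invariant field Y. *)
Definition killing3 (R : realType) (V : lmodType R) (nab : V -> V -> V)
    (a : V -> V -> V -> R) :=
  alternating3 a /\
  forall y u w, a (nab y y) u w + a y (nab y u) w + a y u (nab y w) = 0.

Definition has_killing3 (R : realType) (n : lie_algebra R)
    (ip : 'rV[R]_(lie_dim n) -> 'rV[R]_(lie_dim n) -> R) :=
  exists (nab : {bilinear 'rV[R]_(lie_dim n) -> 'rV[R]_(lie_dim n) ->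
                          'rV[R]_(lie_dim n)}) a,
    [/\ levi_civita_product ip nab, killing3 nab a
      & exists x y z, a x y z != 0].

(** * Left-invariant tensors in the global chart *)

Section Alternating3Calculus.
Variables (R : realType) (p : nat).
Local Notation V := 'rV[R]_p.
Variable a : V -> V -> V -> R.
Hypothesis altA : alternating3 a.

Lemma alt3_bilinear u : bilinear_for *:%R *:%R (a u : V -> V -> R).
Proof. by split=> w c x y; rewrite (alt3P2 altA, alt3P3 altA). Qed.

Lemma alt3_suml (I : finType) (F : I -> V) y z :
  a (\sum_i F i) y z = \sum_i a (F i) y z.
Proof.
by apply: (big_morph (fun x => a x y z)) => [u v|];
  rewrite ?(alt3D1 altA) ?(alt3_01 altA).
Qed.

Lemma alt3_coord1 x y z : a x y z = \sum_i x 0 i * a (delta_mx 0 i) y z.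
Proof.
rewrite {1}[x]row_sum_delta alt3_suml.
by apply: eq_bigr => i _; rewrite (alt3Z1 altA).
Qed.

Lemma is_derive_alt3 (f g h : V -> V) x v df dg dh :
  is_derive x v f df -> is_derive x v g dg -> is_derive x v h dh ->
  is_derive x v (fun z => a (f z) (g z) (h z))
    (a df (g x) (h x) + a (f x) dg (h x) + a (f x) (g x) dh).
Proof.
move=> Df Dg Dh.
have -> : (fun z => a (f z) (g z) (h z)) =
    \sum_i (fun z => f z 0 i * a (delta_mx 0 i) (g z) (h z)).
  by apply/funext => z; rewrite alt3_coord1 fct_sumE.
have H i := is_deriveM (is_derive_coord 0 i Df)
  (is_derive_bilinear (bilinear_map_of (alt3_bilinear (delta_mx 0 i))) Dg Dh).
apply: (is_derive_eq (is_derive_sum H)).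
rewrite /= (alt3_coord1 df) (alt3_coord1 (f x) dg) (alt3_coord1 (f x) _ dh).
rewrite -!big_split /=; apply: eq_bigr => i _.
by rewrite /GRing.scale /=; ring.
Qed.

End Alternating3Calculus.

Lemma is_derive_dot (R : realType) p (ip : {dot 'rV[R]_p for idfun})
    (f g : 'rV[R]_p -> 'rV[R]_p) x v df dg :
  is_derive x v f df -> is_derive x v g dg ->
  is_derive x v (fun z => ip (f z) (g z)) (ip df (g x) + ip (f x) dg).
Proof.
move=> Df Dg.
exact: (is_derive_bilinear (bilinear_map_of (dot_bilinear ip)) Df Dg).
Qed.

(** The differential of the left translation that moves z to the unit. *)
Definition to_unit (R : realType) (n : lie_algebra R)
  (z u : 'rV[R]_(lie_dim n)) := u - 2^-1 *: lie_br n z u.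

Section ToUnit.
Variables (R : realType) (n : lie_algebra R).
Local Notation V := 'rV[R]_(lie_dim n).
Implicit Types u v w x y z : V.

Lemma diff_group_mulN z u : 'd (group_mul (- z)) z u = to_unit z u.
Proof. by rewrite diff_group_mul linearNl scalerN. Qed.

Lemma left_invariant_metricE (ip : {dot V for idfun}) z u v :
  left_invariant_metric ip z u v = ip (to_unit z u) (to_unit z v).
Proof. by rewrite /left_invariant_metric !diff_group_mulN. Qed.

Lemma to_unitD z u v : to_unit z (u + v) = to_unit z u + to_unit z v.
Proof. by rewrite /to_unit linearDr scalerDr opprD addrACA. Qed.

Lemma to_unitZ z c u : to_unit z (c *: u) = c *: to_unit z u.
Proof. by rewrite /to_unit linearZr_LR scalerBr !scalerA mulrC. Qed.

Lemma to_unit0 u : to_unit 0 u = u.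
Proof. by rewrite /to_unit linear0l scaler0 subr0. Qed.

Lemma is_derive_to_unit (Y : V -> V) x v dY :
  is_derive x v Y dY ->
  is_derive x v (fun z => to_unit z (Y z))
    (to_unit x dY - 2^-1 *: lie_br n v (Y x)).
Proof.
move=> DY.
have Dbr := is_derive_bilinear (lie_br n) (is_derive_id x v) DY.
have D := is_deriveB DY (is_deriveZ (2^-1) Dbr).
apply: (is_derive_eq D).
by rewrite /to_unit scalerDr opprD addrA addrAC.
Qed.

Lemma is_derive_to_unit_cst w x v :
  is_derive x v (fun z => to_unit z w) (- (2^-1 *: lie_br n v w)).
Proof.
apply: is_derive_eq; first by apply: is_derive_to_unit; exact: is_derive_cst.
by rewrite /to_unit linear0r scaler0 subrr add0r.
Qed.

End ToUnit.

Lemma smooth_cst (R : realType) p (W : normedModType R) (w : W) :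
  smooth (fun=> w : W) (p := p).
Proof.
move=> s x.
suff [w' ->] : exists w', foldr (fun v h => 'D_v h) (fun=> w : W) s
    = cst w' :> ('rV[R]_p -> W) by exact: differentiable_cst.
elim: s => [|v s [w' IH]] /=; first by exists w.
by exists 0; rewrite IH; apply/funext => z; rewrite derive_cst.
Qed.

Definition triple (T : nmodType) (u v w : T) : 'I_3 -> T :=
  fun i => nth 0 [:: u; v; w] i.

Lemma triple_with (T : nmodType) (u v w z : T) (i : 'I_3) :
  ([eta triple u v w with i |-> z] : 'I_3 -> T) =
  triple (if i == 0%N :> nat then z else u)
    (if i == 1%N :> nat then z else v) (if i == 2%N :> nat then z else w).
Proof.
apply/funext => j /=; rewrite -val_eqE.
by case: i j => [[|[|[|]]]] //= _ [[|[|[|]]]].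
Qed.

Section KillingOfLeftInvariant.
Variables (R : realType) (n : lie_algebra R).
Local Notation V := 'rV[R]_(lie_dim n).
Variables (ip : {dot V for idfun}).

(** Translating by the inverse of x, which is - x in this chart. *)
Lemma left_invariant_formE (alpha : V -> ('I_3 -> V) -> R) x v :
  left_invariant_form alpha ->
  alpha x v = alpha 0 (fun i => to_unit x (v i)).
Proof.
move=> linv; rewrite -(linv (- x)).
have -> : group_mul (- x) x = 0.
  by rewrite /group_mul addNr linearNl lie_alt oppr0 scaler0 addr0.
by congr (alpha 0 _); apply/funext => i; rewrite diff_group_mulN.
Qed.

Lemma form_at0_alternating3 (alpha : V -> ('I_3 -> V) -> R) :
  differential_form alpha -> alternating3 (fun u v w => alpha 0 (triple u v w)).
Proof.
case=> lin alt _.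
pose A u v w := alpha 0 (triple u v w).
have P1 v w c u u' : A (c *: u + u') v w = c * A u v w + A u' v w.
  by have := lin 0 (triple 0 v w) (@Ordinal 3 0 isT) c u u'; rewrite !triple_with.
have P2 v w c u u' : A v (c *: u + u') w = c * A v u w + A v u' w.
  by have := lin 0 (triple v 0 w) (@Ordinal 3 1 isT) c u u'; rewrite !triple_with.
have P3 v w c u u' : A v w (c *: u + u') = c * A v w u + A v w u'.
  by have := lin 0 (triple v w 0) (@Ordinal 3 2 isT) c u u'; rewrite !triple_with.
have E12 u w : A u u w = 0.
  by apply: (alt _ _ (@Ordinal 3 0 isT) (@Ordinal 3 1 isT)).
have E23 u w : A w u u = 0.
  by apply: (alt _ _ (@Ordinal 3 1 isT) (@Ordinal 3 2 isT)).
have S12 u v w : A u v w = - A v u w.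
  apply/eqP; rewrite -addr_eq0; apply/eqP.
  have := E12 (1 *: u + v) w; rewrite P1 !P2 !E12; lra.
have S23 u v w : A u v w = - A u w v.
  apply/eqP; rewrite -addr_eq0; apply/eqP.
  have := E23 (1 *: v + w) u; rewrite P2 !P3 !E23; lra.
split=> [v w c u u'|u v w|u w]; first exact: P1; last exact: E12.
by change (A u v w = A v w u); rewrite S12 S23 opprK.
Qed.

End KillingOfLeftInvariant.

(** * Killing forms of the group restrict to the Lie algebra *)

Lemma triple_eta (T : nmodType) (v : 'I_3 -> T) :
  v = triple (v (@Ordinal 3 0 isT)) (v (@Ordinal 3 1 isT)) (v (@Ordinal 3 2 isT)).
Proof.
by apply/funext => -[[|[|[|]]]] //= i3; congr v; exact: val_inj.
Qed.

Lemma contraction_exterior3 (R : realType) p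
    (alpha : 'rV[R]_p -> ('I_3 -> 'rV[R]_p) -> R) x y v0 v1 v2 :
  Defs.contraction (exterior_derivative alpha x) y (triple v0 v1 v2) =
    'D_y (fun z => alpha z (triple v0 v1 v2) : R^o) x
    - 'D_v0 (fun z => alpha z (triple y v1 v2) : R^o) x
    + 'D_v1 (fun z => alpha z (triple y v0 v2) : R^o) x
    - 'D_v2 (fun z => alpha z (triple y v0 v1) : R^o) x.
Proof.
rewrite /Defs.contraction /exterior_derivative.
pose w := fun i : 'I_4 =>
  if unlift ord0 i is Some j then triple v0 v1 v2 j else y.
rewrite -/w.
have wE i : w i = nth 0 [:: y; v0; v1; v2] i.
  rewrite /w; case: unliftP => [j|] ->; by [].
have wL i : w \o lift i = triple (w (lift i (@Ordinal 3 0 isT)))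
  (w (lift i (@Ordinal 3 1 isT))) (w (lift i (@Ordinal 3 2 isT))).
  exact: (triple_eta (w \o lift i)).
rewrite !big_ord_recl big_ord0 addr0 !wL /= !wE /=.
rewrite /bump /= !exprS !expr0 !mulN1r ?mulr1 ?opprK ?mul1r ?mulN1r.
by rewrite unlift_none !liftK /= !addrA.
Qed.

(** Everything is read off at the unit from constant fields. There the
    derivative of to_unit contributes minus half a bracket, so the product nab is the
    Christoffel symbol plus half the bracket. For the arguments y, u, w along y, the
    exterior derivative is evaluated twice on y and drops out. *)
Lemma left_invariant_killing_algebra (R : realType) (n : lie_algebra R)
    (ip : {dot 'rV[R]_(lie_dim n) for idfun}) :
  carries_left_invariant_killing_form 3 ip -> has_killing3 ip.
Proof.
case=> alpha [[form [Gamma [LC K]]] linv [x0 [v0 nz]]].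
set V := 'rV[R]_(lie_dim n) in form LC K *.
pose A u v w := alpha 0 (triple u v w).
have altA : alternating3 A := form_at0_alternating3 form.
have alphaE x u v w :
    alpha x (triple u v w) = A (to_unit x u) (to_unit x v) (to_unit x w).
  rewrite (left_invariant_formE _ _ linv) /A; congr (alpha 0 _).
  by rewrite [LHS]triple_eta.
have nab_bil : bilinear_for *:%R *:%R
    (fun u v : V => Gamma 0 u v + 2^-1 *: lie_br n u v).
  by split=> w c u v /=; rewrite ?linearPl ?linearPr !scalerDr !scalerA (mulrC 2^-1) addrACA.
have D0 (u v : V) : 'D_u (fun=> v) 0 = 0 by exact: derive_cst.
have nabla0 (u v : V) : nabla Gamma (fun=> u) (fun=> v) 0 = Gamma 0 u v.
  by rewrite /nabla D0 add0r.
exists (bilinear_of nab_bil), A; split; last first.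
- exists (to_unit x0 (v0 (@Ordinal 3 0 isT))), (to_unit x0 (v0 (@Ordinal 3 1 isT))).
  exists (to_unit x0 (v0 (@Ordinal 3 2 isT))).
  by rewrite -alphaE -triple_eta.
- split=> // y u w /=.
  have := K _ (smooth_cst y) 0 (triple y u w).
  rewrite contraction_exterior3 /nabla_form !big_ord_recl big_ord0 addr0.
  rewrite !triple_with /= !nabla0 /=.
  have Dyy (v w' : V) : 'D_v (fun z => alpha z (triple y y w')) 0 = 0.
    under eq_fun do rewrite alphaE (alt3_eq12 altA).
    exact: derive_cst.
  rewrite subrr !Dyy subr0 addr0 mulr0.
  rewrite -[triple y u w ord0]/y -[triple y u w (lift ord0 ord0)]/u.
  rewrite -[triple y u w (lift ord0 (lift ord0 ord0))]/w.
  have -> : 'D_y (fun z => alpha z (triple y u w)) 0 =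
      - 2^-1 * (A (lie_br n y y) u w + A y (lie_br n y u) w + A y u (lie_br n y w)).
    under eq_fun do rewrite alphaE.
    have [_ ->] := is_derive_alt3 altA (is_derive_to_unit_cst y 0 y)
      (is_derive_to_unit_cst u 0 y) (is_derive_to_unit_cst w 0 y).
    rewrite !to_unit0 (alt3N1 altA) (alt3N2 altA) (alt3N3 altA).
    by rewrite (alt3Z1 altA) (alt3Z2 altA) (alt3Z3 altA); ring.
  rewrite -!/(A _ _ _) (alt3D1 altA) (alt3D2 altA) (alt3D3 altA).
  by rewrite (alt3Z1 altA) (alt3Z2 altA) (alt3Z3 altA); lra.
have LC0 u v w := LC _ _ _ (smooth_cst u) (smooth_cst v) (smooth_cst w) 0.
split=> [u v|u v w] /=.
  have [+ _] := LC0 u v 0.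
  rewrite !nabla0 /vf_bracket !D0 subrr => /eqP; rewrite subr_eq0 => /eqP ->.
  rewrite opprD addrACA subrr add0r (lie_antisym v) scalerN opprK -scalerDl.
  by rewrite (_ : 2^-1 + 2^-1 = 1 :> R) ?scale1r //; field.
have [_] := LC0 u v w; rewrite !nabla0 !left_invariant_metricE !to_unit0.
have [_ ->] : is_derive (0 : V) u (fun z => left_invariant_metric ip z v w)
    (ip (- (2^-1 *: lie_br n u v)) w + ip v (- (2^-1 *: lie_br n u w))).
  under eq_fun do rewrite left_invariant_metricE.
  apply: is_derive_eq.
    by apply: is_derive_dot; exact: is_derive_to_unit_cst.
  by rewrite /= !to_unit0.
rewrite !dotDl !dotDr dotNl dotNr; lra.
Qed.

(** * Killing forms of the Lie algebra extend to the group *)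

(** The group law is polynomial in the global chart, and so are the
    coefficients of left-invariant forms; this makes them smooth. *)
Inductive polynomial_function (R : realType) p : ('rV[R]_p -> R) -> Prop :=
| PolynomialCst c : polynomial_function (cst c)
| PolynomialCoord j : polynomial_function (fun x => x 0 j)
| PolynomialD f g : polynomial_function f -> polynomial_function g ->
    polynomial_function (fun x => f x + g x)
| PolynomialM f g : polynomial_function f -> polynomial_function g ->
    polynomial_function (fun x => f x * g x).

Section PolynomialFunctions.
Variables (R : realType) (p : nat).
Implicit Types f g : 'rV[R]_p -> R.

Lemma polynomial_sum (I : finType) (F : I -> 'rV[R]_p -> R) :
  (forall i, polynomial_function (F i)) ->
  polynomial_function (fun x => \sum_i F i x).
Proof.
move=> PF; suff H s : polynomial_function (fun x => \sum_(i <- s) F i x).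
  exact: H.
elim: s => [|i s IH].
  rewrite (_ : (fun x => _) = cst 0); first exact: PolynomialCst.
  by apply/funext => x; rewrite big_nil.
rewrite (_ : (fun x => _) = F i \+ (fun x => \sum_(i <- s) F i x)).
  exact: PolynomialD.
by apply/funext => x; rewrite big_cons.
Qed.

Lemma polynomial_differentiable f x :
  polynomial_function f -> differentiable f x.
Proof.
elim=> {f} [c|j|f g _ Df _ Dg|f g _ Df _ Dg].
- exact: differentiable_cst.
- exact: differentiable_coord.
- exact: differentiableD.
- exact: differentiableM.
Qed.

Lemma polynomial_derive f v :
  polynomial_function f -> polynomial_function ('D_v f).
Proof.
elim=> {f} [c|j|f g Pf Df Pg Dg|f g Pf Df Pg Dg].
- rewrite (_ : 'D_v _ = cst 0); first exact: PolynomialCst.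
  by apply/funext => x; rewrite derive_cst.
- rewrite (_ : 'D_v _ = cst (v 0 j)); first exact: PolynomialCst.
  apply/funext => x.
  by have [_ ->] := is_derive_coord 0 j (is_derive_id x v).
- rewrite (_ : 'D_v _ = 'D_v f \+ 'D_v g); first exact: PolynomialD.
  apply/funext => x; apply: deriveD; apply: diff_derivable;
  exact: polynomial_differentiable.
- rewrite (_ : 'D_v _ = (f \* 'D_v g) \+ (g \* 'D_v f)).
    by apply: PolynomialD; apply: PolynomialM.
  apply/funext => x; apply: deriveM; apply: diff_derivable;
  exact: polynomial_differentiable.
Qed.

Lemma polynomial_smooth f : polynomial_function f -> smooth (f : _ -> R^o).
Proof.
move=> Pf s x; apply: polynomial_differentiable.
by elim: s => //= v s; exact: polynomial_derive.
Qed.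

End PolynomialFunctions.

Lemma polynomial_alt3 (R : realType) p (a : 'rV[R]_p -> 'rV[R]_p -> 'rV[R]_p -> R)
    (f g h : 'rV[R]_p -> 'rV[R]_p) :
  alternating3 a ->
  (forall i, polynomial_function (fun x => f x 0 i)) ->
  (forall i, polynomial_function (fun x => g x 0 i)) ->
  (forall i, polynomial_function (fun x => h x 0 i)) ->
  polynomial_function (fun x => a (f x) (g x) (h x)).
Proof.
move=> altA Pf Pg Ph.
rewrite (_ : (fun x => _) = fun x => \sum_i f x 0 i *
    \sum_j g x 0 j * \sum_k h x 0 k * a (delta_mx 0 k) (delta_mx 0 i) (delta_mx 0 j)).
  apply: polynomial_sum => i; apply: PolynomialM (Pf i) _.
  apply: polynomial_sum => j; apply: PolynomialM (Pg j) _.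
  by apply: polynomial_sum => k; apply: PolynomialM (Ph k) (PolynomialCst _ _).
apply/funext => x; rewrite (alt3_coord1 altA); apply: eq_bigr => i _.
congr (_ * _); rewrite (alt3_rot altA) (alt3_coord1 altA); apply: eq_bigr => j _.
by congr (_ * _); rewrite (alt3_rot altA) (alt3_coord1 altA).
Qed.

Lemma polynomial_to_unit (R : realType) (n : lie_algebra R) w i :
  polynomial_function (fun z => (to_unit (n := n) z w) 0 i).
Proof.
rewrite (_ : (fun z => _) = fun z : 'rV_(lie_dim n) => cst (w 0 i) z +
  cst (- 2^-1) z * \sum_j z 0 j * lie_br n (delta_mx 0 j) w 0 i).
  apply: PolynomialD (PolynomialCst _ _) _; apply: PolynomialM (PolynomialCst _ _) _.
  apply: polynomial_sum => j.
  by apply: PolynomialM; [exact: PolynomialCoord | exact: PolynomialCst].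
apply/funext => z; rewrite /to_unit /= !mxE mulNr; congr (_ - _ * _).
rewrite {1}[z]row_sum_delta linear_sumlz summxE; apply: eq_bigr => j _.
by rewrite linearZl_LR mxE.
Qed.

(** The sign-weighted sum over the four arguments of the three bracket terms
    counts each pair of arguments twice, whereas an alternating T is counted
    four times. *)
Lemma alternating_sum_torsion (R : realFieldType) (V : Type)
    (N : V -> V -> V -> V -> R)
    (M := fun y u v w => N y u v w - N u y v w)
    (T := fun y u v w => N y u v w - N y v u w + N y w u v)
    (P := fun y u v w => M y u v w - M y v u w + M y w u v) :
  (forall y u v w, N y u v w = - N y u w v) ->
  (forall y u v w, T y u v w = - T u y v w) ->
  forall y u v w,
  T y u v w = 8^-1 * (P y u v w - P u y v w + P v y u w - P w y u v).
Proof.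
rewrite /T /P /M => NC TC y u v w.
have := TC y u v w; have := TC y v u w; have := TC y w u v.
move: (NC y u v w) (NC y v u w) (NC y w u v) (NC u y v w)
  (NC u v y w) (NC u w y v) (NC v y u w) (NC v u y w)
  (NC v w y u) (NC w y u v) (NC w u y v) (NC w v y u).
lra.
Qed.

Section LeftInvariantKilling.
Variables (R : realType) (n : lie_algebra R).
Hypothesis n2 : two_step_nilpotent n.
Local Notation V := 'rV[R]_(lie_dim n).
Variables (ip : {dot V for idfun}) (nab : {bilinear V -> V -> V}).
Variable a : V -> V -> V -> R.
Hypothesis nabLC : levi_civita_product ip nab.
Hypothesis nabK : killing3 nab a.
Implicit Types u v w x y z : V.

Let altA : alternating3 a := proj1 nabK.

Lemma two_step_brl x y z : lie_br n (lie_br n x y) z = 0.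
Proof. exact: (proj2 n2). Qed.

Lemma two_step_brr x y z : lie_br n x (lie_br n y z) = 0.
Proof. by rewrite lie_antisym two_step_brl oppr0. Qed.

Definition from_unit z u : V := u + 2^-1 *: lie_br n z u.

Lemma from_unitK z u : to_unit z (from_unit z u) = u.
Proof.
rewrite /to_unit /from_unit linearDr linearZr_LR /= two_step_brr.
by rewrite scaler0 addr0 addrK.
Qed.

Lemma to_unit_br z u v : lie_br n (to_unit z u) (to_unit z v) = lie_br n u v.
Proof.
rewrite /to_unit linearBl !linearBr !linearZl_LR !linearZr_LR /=.
by rewrite !two_step_brl !two_step_brr !scaler0 !subr0.
Qed.

Lemma to_unit_group_mul b x v :
  to_unit (group_mul b x) (v + 2^-1 *: lie_br n b v) = to_unit x v.
Proof.
rewrite /to_unit /group_mul !linearDl !linearDr /= !linearZl_LR !linearZr_LR /=.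
rewrite !two_step_brl !two_step_brr !scaler0 !addr0 scalerDr opprD.
by rewrite addrA addrK.
Qed.

Lemma to_unitK z u : from_unit z (to_unit z u) = u.
Proof.
rewrite /to_unit /from_unit linearBr linearZr_LR /= two_step_brr.
by rewrite scaler0 subr0 subrK.
Qed.

Lemma from_unitP z c u v :
  from_unit z (c *: u + v) = c *: from_unit z u + from_unit z v.
Proof.
by rewrite /from_unit linearPr /= !scalerDr !scalerA (mulrC _ c) addrACA.
Qed.

(** Left translation of the Christoffel symbol nab - [ , ] / 2 at the unit;
    from_unit inverts to_unit because brackets are central. *)
Lemma christoffel_exists : exists Gamma : connection R (lie_dim n),
  forall x u v, to_unit x (Gamma x u v) =
    nab (to_unit x u) (to_unit x v) - 2^-1 *: lie_br n u v.
Proof.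
pose G u v := nab u v - 2^-1 *: lie_br n u v.
have GP1 c u v w : G (c *: u + v) w = c *: G u w + G v w.
  rewrite /G !linearPl /= scalerBr [_ *: (_ + _)]scalerDr opprD addrACA.
  by rewrite !scalerA (mulrC c).
have GP2 c u v w : G w (c *: u + v) = c *: G w u + G w v.
  rewrite /G !linearPr /= scalerBr [_ *: (_ + _)]scalerDr opprD addrACA.
  by rewrite !scalerA (mulrC c).
have bil x : bilinear_for *:%R *:%R
    (fun u v => from_unit x (G (to_unit x u) (to_unit x v))).
  split=> w c u v; rewrite to_unitD to_unitZ ?GP1 ?GP2; exact: from_unitP.
exists (fun x => bilinear_of (bil x)) => x u v.
by rewrite [LHS]from_unitK /G to_unit_br.
Qed.

Variable Gamma : connection R (lie_dim n).
Hypothesis GammaE : forall x u v, to_unit x (Gamma x u v) =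
  nab (to_unit x u) (to_unit x v) - 2^-1 *: lie_br n u v.

Definition form_of x (v : 'I_3 -> V) : R :=
  a (to_unit x (v (@Ordinal 3 0 isT))) (to_unit x (v (@Ordinal 3 1 isT)))
    (to_unit x (v (@Ordinal 3 2 isT))).

(** The torsion of nab is the bracket, which cancels the antisymmetric part. *)
Lemma christoffelC x u v : Gamma x u v = Gamma x v u.
Proof.
rewrite -[LHS](to_unitK x) -[RHS](to_unitK x) !GammaE; congr (from_unit x _).
rewrite -!(to_unit_br x u) -!(to_unit_br x v).
set A := to_unit x u; set B := to_unit x v.
rewrite -[nab A B](subrK (nab B A)) (proj1 nabLC) (lie_antisym B) scalerN opprK.
rewrite addrAC -{1}[lie_br n A B]scale1r -scalerBl addrC.
by rewrite (_ : 1 - 2^-1 = 2^-1 :> R) //; field.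
Qed.

Lemma smooth_derivable (Y : V -> V) x v : smooth Y -> is_derive x v Y ('D_v Y x).
Proof. by move=> sY; apply: derivableP; apply: diff_derivable; exact: (sY [::]). Qed.

Lemma christoffel_levi_civita : levi_civita (left_invariant_metric ip) Gamma.
Proof.
move=> X Y Z sX sY sZ x; split.
  by rewrite /nabla /vf_bracket (christoffelC x (Y x)) opprD addrACA subrr addr0.
have DY := smooth_derivable x (X x) sY; have DZ := smooth_derivable x (X x) sZ.
rewrite (_ : (fun z => _) =
  fun z => ip (to_unit z (Y z)) (to_unit z (Z z))); last first.
  by apply/funext => z; rewrite left_invariant_metricE.
have [_ ->] := is_derive_dot ip (is_derive_to_unit DY) (is_derive_to_unit DZ).
have nablaE (T U : V -> V) : to_unit x (nabla Gamma T U x) =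
    to_unit x ('D_(T x) U x) + (nab (to_unit x (T x)) (to_unit x (U x))
    - 2^-1 *: lie_br n (T x) (U x)) by rewrite [LHS]to_unitD GammaE.
rewrite 2!left_invariant_metricE (nablaE X Y) (nablaE X Z).
have := proj2 nabLC (to_unit x (X x)) (to_unit x (Y x)) (to_unit x (Z x)).
rewrite !dotDl !dotDr; lra.
Qed.

Lemma form_of_differential : differential_form form_of.
Proof.
split.
- move=> x v i c u u'; rewrite /form_of /=.
  case: i => [[|[|[|]]]] //= i3; rewrite to_unitD to_unitZ.
  + by rewrite (alt3P1 altA).
  + by rewrite (alt3P2 altA).
  + by rewrite (alt3P3 altA).
- move=> x v i j ij vij; rewrite /form_of.
  move: ij vij; rewrite [v]triple_eta.
  case: i => [[|[|[|]]] i3] //; case: j => [[|[|[|]]] j3] //= _;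
  rewrite /triple /= => ->;
  first [exact: alt3_eq12 altA _ _ | exact: alt3_eq13 altA _ _
        | exact: alt3_eq23 altA _ _].
- move=> v; apply: polynomial_smooth; apply: polynomial_alt3 altA _ _ _ => i;
  exact: polynomial_to_unit.
Qed.

Lemma form_of_left_invariant : left_invariant_form form_of.
Proof. by move=> b x v; rewrite /form_of !diff_group_mul !to_unit_group_mul. Qed.

Lemma killing3_swap y u v w :
  a (nab y u) v w + a u (nab y v) w + a u v (nab y w)
  = - (a (nab u y) v w + a y (nab u v) w + a y v (nab u w)).
Proof.
have := proj2 nabK (y + u) v w; have := proj2 nabK y v w; have := proj2 nabK u v w.
rewrite !linearDl !linearDr /= !(alt3D1 altA, alt3D2 altA, alt3D3 altA).
lra.
Qed.

(** For a Killing form the covariant derivative is already alternating, hence a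
    quarter of the exterior derivative, in which only the torsion of nab appears. *)
Lemma killing3_torsion y u v w (M := fun y u v w => a (lie_br n y u) v w)
    (P := fun y u v w => M y u v w - M y v u w + M y w u v) :
  a (nab y u) v w + a u (nab y v) w + a u v (nab y w)
  = 8^-1 * (P y u v w - P u y v w + P v y u w - P w y u v).
Proof.
have a2 z z1 z2 z' : a z (nab z1 z2) z' = - a (nab z1 z2) z z'.
  exact: alt3_swap12 altA _ _ _.
have a3 z z' z1 z2 : a z z' (nab z1 z2) = a (nab z1 z2) z z'.
  by rewrite (alt3_rot altA) (alt3_rot altA).
have ME z1 z2 z z' : M z1 z2 z z' = a (nab z1 z2) z z' - a (nab z2 z1) z z'.
  by rewrite /M -(proj1 nabLC) (alt3D1 altA) (alt3N1 altA).
rewrite /P !ME a2 a3.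
apply: (alternating_sum_torsion (N := fun y u v w => a (nab y u) v w)).
  by move=> y' u' v' w'; exact: alt3_swap23 altA _ _ _.
by move=> y' u' v' w'; have := killing3_swap y' u' v' w'; rewrite !(a2, a3).
Qed.

Lemma form_of_killing : killing_form (left_invariant_metric ip) form_of.
Proof.
split; first exact: form_of_differential.
exists Gamma; split=> [|Y sY x v]; first exact: christoffel_levi_civita.
rewrite [v]triple_eta.
move: (v _) (v _) (v _) => v0 v1 v2; set y := Y x.
have D w u0 u1 u2 : 'D_w (fun z => form_of z (triple u0 u1 u2)) x =
    - 2^-1 * (a (lie_br n w u0) (to_unit x u1) (to_unit x u2)
            + a (to_unit x u0) (lie_br n w u1) (to_unit x u2)
            + a (to_unit x u0) (to_unit x u1) (lie_br n w u2)).
  have [_ ->] := is_derive_alt3 altA (is_derive_to_unit_cst u0 x w)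
    (is_derive_to_unit_cst u1 x w) (is_derive_to_unit_cst u2 x w).
  rewrite (alt3N1 altA) (alt3N2 altA) (alt3N3 altA).
  by rewrite (alt3Z1 altA) (alt3Z2 altA) (alt3Z3 altA); ring.
have nablaE w : nabla Gamma Y (fun=> w) x = Gamma x y w.
  by rewrite /nabla (_ : 'D_(Y x) _ x = 0) ?add0r //; exact: derive_cst.
rewrite contraction_exterior3 /nabla_form !big_ord_recl big_ord0 addr0.
rewrite !triple_with !D !nablaE.
rewrite /form_of /triple /= !GammaE -/y.
have [B [brE BE]] : exists B : V -> V -> V,
    (forall u w, lie_br n u w = B (to_unit x u) (to_unit x w)) /\ B = lie_br n.
  by exists (lie_br n); split=> // u w; rewrite to_unit_br.
rewrite !brE {}BE.
move: (to_unit x y) (to_unit x v0) (to_unit x v1) (to_unit x v2).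
move=> {D nablaE brE v0 v1 v2} t u2 u1 u0.
have a2 z u w z' : a z (lie_br n u w) z' = - a (lie_br n u w) z z'.
  exact: alt3_swap12 altA _ _ _.
have a3 z z' u w : a z z' (lie_br n u w) = a (lie_br n u w) z z'.
  by rewrite (alt3_rot altA) (alt3_rot altA).
have := killing3_torsion t u0 u1 u2.
rewrite !(alt3D1 altA, alt3D2 altA, alt3D3 altA, alt3N1 altA, alt3N2 altA,
  alt3N3 altA, alt3Z1 altA, alt3Z2 altA, alt3Z3 altA) !(a2, a3) /=.
lra.
Qed.

End LeftInvariantKilling.

Lemma killing_algebra_left_invariant (R : realType) (n : lie_algebra R)
    (ip : {dot 'rV[R]_(lie_dim n) for idfun}) :
  two_step_nilpotent n -> has_killing3 ip ->
  carries_left_invariant_killing_form 3 ip.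
Proof.
move=> n2 [nab [a [nabLC nabK [x [y [z nz]]]]]].
have [Gamma GammaE] := christoffel_exists n2 nab.
exists (form_of a); split.
- exact: (form_of_killing n2 nabLC nabK GammaE).
- exact: form_of_left_invariant.
- by exists 0, (triple x y z); rewrite /form_of !to_unit0.
Qed.

(** * Inner products and connections on the models *)

Section DotOf.
Variables (R : realType) (p : nat) (b : 'rV[R]_p -> 'rV[R]_p -> R).
Hypothesis b_sym : forall u v, b u v = b v u.
Hypothesis b_lin : forall w, scalar (fun u => b u w).
Hypothesis b_pos : forall u, u != 0 -> 0 < b u u.

Fact dot_of_bilinear : bilinear_for *%R (idfun \; *%R) b.
Proof.
split=> w c u v /=; first exact: (b_lin w c u v).
by rewrite !(b_sym w) (b_lin w c u v).
Qed.

Fact dot_of_hermitian u v : b u v = (-1) ^+ false * idfun (b v u).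
Proof. by rewrite expr0 mul1r b_sym. Qed.

Definition dot_of : {dot 'rV[R]_p for idfun} :=
  HB.pack b (bilinear_isBilinear.Build R _ _ _ _ _ b dot_of_bilinear)
    (isHermitianSesquilinear.Build R _ false idfun b dot_of_hermitian)
    (isDotProduct.Build R _ b b_pos).

End DotOf.

Section RowDot.
Variables (R : realType) (p : nat).
Implicit Types u v w : 'rV[R]_p.

Definition row_dot u v : R := \sum_i u 0 i * v 0 i.

Lemma row_dotC u v : row_dot u v = row_dot v u.
Proof. by apply: eq_bigr => i _; rewrite mulrC. Qed.

Lemma row_dotP c u v w : row_dot (c *: u + v) w = c * row_dot u w + row_dot v w.
Proof.
rewrite /row_dot mulr_sumr -big_split /=.
by apply: eq_bigr => i _; rewrite !mxE mulrDl mulrA.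
Qed.

Lemma row_dot_gt0 u : u != 0 -> 0 < row_dot u u.
Proof.
move=> u0; rewrite lt0r sumr_ge0 ?andbT; last by move=> i _; rewrite -expr2 sqr_ge0.
apply: contra u0 => /eqP/psumr_eq0P H; apply/eqP/rowP => i; rewrite mxE.
have /eqP := H (fun j _ => sqr_ge0 (u 0 j)) i isT.
by rewrite mulf_eq0 orbb => /eqP.
Qed.

Definition std_dot : {dot 'rV[R]_p for idfun} :=
  dot_of row_dotC (fun w c u v => row_dotP c u v w) row_dot_gt0.

End RowDot.

Definition standard_killing3 (R : realType) (n : lie_algebra R) :=
  has_killing3 (n := n) (@row_dot R (lie_dim n)).

Lemma killing3_transport (R : realType) (n m : lie_algebra R) :
  lie_iso n m -> standard_killing3 m ->
  exists ip : {dot 'rV[R]_(lie_dim n) for idfun}, has_killing3 ip.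
Proof.
case=> f [[g fK gK] fbr] [nab [a [[nabT nabS] [altA K] [x [y [z nz]]]]]].
have gbr u v : g (lie_br m u v) = lie_br n (g u) (g v).
  by apply: (can_inj fK); rewrite fbr !gK.
have gP c u v : g (c *: u + v) = c *: g u + g v.
  by apply: (can_inj fK); rewrite linearP !gK.
have gB u v : g (u - v) = g u - g v.
  by rewrite -scaleN1r addrC gP scaleN1r addrC.
pose b u v := std_dot R _ (f u) (f v).
have bS u v : b u v = b v u by exact: dotC.
have bL w : scalar (b^~ w) by move=> c u v; rewrite /b linearP dotDl dotZl.
have bP u : u != 0 -> 0 < b u u.
  by move=> u0; apply: dot_gt0; rewrite -(raddf0 f) (can_eq fK).
pose nb u v := g (nab (f u) (f v)).
have nb_bil : bilinear_for *:%R *:%R nb.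
  by split=> w c u v; rewrite /nb linearP ?linearPl ?linearPr gP.
exists (dot_of bS bL bP), (bilinear_of nb_bil), (fun u v w => a (f u) (f v) (f w)).
split.
- split=> [u v|u v w] /=; first by rewrite /nb -gB nabT gbr !fK.
  by rewrite /b /nb !gK; exact: nabS.
- split=> [|u v w] /=; last by rewrite /nb !gK K.
  split=> [v w c u u'|u v w|u w].
  + by rewrite linearP (alt3P1 altA).
  + exact: alt3_rot altA _ _ _.
  + exact: alt3_eq12 altA _ _.
- by exists (g x), (g y), (g z); rewrite !gK.
Qed.

(** The Koszul formula in the standard inner product. *)
Lemma levi_civita_product_exists (R : realType) (n : lie_algebra R) :
  exists nab : {bilinear 'rV[R]_(lie_dim n) -> 'rV[R]_(lie_dim n) ->
                         'rV[R]_(lie_dim n)},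
    levi_civita_product (@row_dot R (lie_dim n)) nab.
Proof.
pose dt := std_dot R (lie_dim n).
pose K u v w : R := 2^-1 * (dt (lie_br n u v) w - dt v (lie_br n u w)
  - dt u (lie_br n v w)).
have KP1 w w' c u v : K (c *: u + v) w w' = c * K u w w' + K v w w'.
  by rewrite /K !(linearPl (lie_br n)) !(dotDl, dotDr, dotZl, dotZr); ring.
have KP2 w w' c u v : K w (c *: u + v) w' = c * K w u w' + K w v w'.
  rewrite /K !(linearPl (lie_br n)) !(linearPr (lie_br n)).
  by rewrite !(dotDl, dotDr, dotZl, dotZr); ring.
have KP3 w w' c u v : K w w' (c *: u + v) = c * K w w' u + K w w' v.
  by rewrite /K !(linearPr (lie_br n)) !(dotDl, dotDr, dotZl, dotZr); ring.
pose nb u v := \row_k K u v (delta_mx 0 k).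
have nb_bil : bilinear_for *:%R *:%R nb.
  by split=> w c u v; apply/rowP => k; rewrite !mxE (KP1, KP2).
have nbE u v w : row_dot (nb u v) w = K u v w.
  have K_lin : linear (K u v : _ -> R) by move=> c w1 w2; rewrite KP3.
  rewrite -[RHS]/(linear_of K_lin w) [in RHS](row_sum_delta w) linear_sum.
  by apply: eq_bigr => i _; rewrite linearZ mxE /= mulrC.
exists (bilinear_of nb_bil); split=> [u v|u v w] /=.
  apply/eqP; rewrite -subr_eq0; apply/eqP; apply: (@dot_eq0 _ _ dt).
  set t := _ - _; rewrite {1}/t !dotBl.
  have E1 s r : dt (nb s r) t = K s r t by exact: nbE.
  by rewrite !E1 /K (lie_antisym v u) !dotNl; field.
rewrite (row_dotC v) !nbE /K (lie_antisym w v) !dotNr !(dotC dt (lie_br n _ _)).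
by ring.
Qed.

(** * Killing forms on the models *)

Section StandardModels.
Variable R : realType.

Lemma row_dot_mx p q (u u' : 'rV[R]_p) (v v' : 'rV[R]_q) :
  row_dot (row_mx u v) (row_mx u' v') = row_dot u u' + row_dot v v'.
Proof.
rewrite /row_dot big_split_ord /=.
by congr (_ + _); apply: eq_bigr => i _; rewrite ?row_mxEl ?row_mxEr.
Qed.

Lemma row_dot_split p q (u v : 'rV[R]_(p + q)) :
  row_dot u v = row_dot (lsubmx u) (lsubmx v) + row_dot (rsubmx u) (rsubmx v).
Proof. by rewrite -row_dot_mx !hsubmxK. Qed.

(** The connection of a product is the product of the connections, so Killing
    forms of a factor pull back. *)
Lemma lie_dsum_killing3 (n m : lie_algebra R) :
  standard_killing3 m -> standard_killing3 (lie_dsum n m).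
Proof.
case=> [nabm [a [[nabmT nabmS] [altA K] [x [y [z nz]]]]]].
have [nabn [nabnT nabnS]] := levi_civita_product_exists n.
pose nb (u v : 'rV[R]_(lie_dim n + lie_dim m)) : 'rV[R]_(lie_dim n + lie_dim m) :=
  row_mx (nabn (lsubmx u) (lsubmx v)) (nabm (rsubmx u) (rsubmx v)).
have nb_bil : bilinear_for *:%R *:%R nb.
  split=> w c u v; rewrite /= /nb scale_row_mx add_row_mx !linearP //=.
  by rewrite !linearPl.
exists (bilinear_of nb_bil), (fun u v w => a (rsubmx u) (rsubmx v) (rsubmx w)).
split.
- split=> [u v|u v w].
    by rewrite /= /nb opp_row_mx add_row_mx nabnT nabmT.
  rewrite !(@row_dot_split (lie_dim n) (lie_dim m)) /= /nb !row_mxKl !row_mxKr.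
  by rewrite addrACA nabnS nabmS addr0.
- split=> [|u v w] /=; last by rewrite /nb !row_mxKr K.
  split=> [v w c u u'|u v w|u w].
  + by rewrite linearP (alt3P1 altA).
  + exact: alt3_rot altA _ _ _.
  + exact: alt3_eq12 altA _ _.
- by exists (row_mx 0 x), (row_mx 0 y), (row_mx 0 z); rewrite !row_mxKr.
Qed.

Lemma row_dot_riesz p (f : {linear 'rV[R]_p -> R}) v :
  row_dot (\row_k f (delta_mx 0 k)) v = f v.
Proof.
rewrite [in RHS](row_sum_delta v) linear_sum.
by apply: eq_bigr => i _; rewrite linearZ mxE /= mulrC.
Qed.

(** Let eta be dual to z and om the scalar bracket, given by the skew map J. The
    connection is nab u v = (om u v z - eta v J u - eta u J v) / 2. Substituted in
    the equation for the wedge product of eta and om, it leaves products of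
    two values of om and terms in the symmetric form <J u, J v>, which cancel in
    pairs. *)
Lemma contact_killing3 (n : lie_algebra R) (z : 'rV[R]_(lie_dim n)) :
  row_dot z z = 1 -> (forall x, lie_br n x z = 0) ->
  (forall x y, lie_br n x y = row_dot (lie_br n x y) z *: z) ->
  (exists x y, lie_br n x y != 0) -> standard_killing3 n.
Proof.
move=> zz brz brE [x0 [y0 nz]].
pose d := std_dot R (lie_dim n).
pose om u v : R := d (lie_br n u v) z.
pose et u : R := d u z.
have omP1 c u v w : om (c *: u + v) w = c * om u w + om v w.
  by rewrite /om (linearPl (lie_br n)) dotDl dotZl.
have omC u v : om u v = - om v u by rewrite /om lie_antisym dotNl.
have omU u : om u u = 0 by rewrite /om lie_alt dot0l.
have omP2 c u v w : om w (c *: u + v) = c * om w u + om w v.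
  by rewrite omC omP1 !(omC w); ring.
have omZ u : om u z = 0 by rewrite /om brz dot0l.
have omZ' u : om z u = 0 by rewrite omC omZ oppr0.
have om_lin u : linear (om u : _ -> R) by move=> c v w; rewrite omP2.
pose J u := \row_k om u (delta_mx 0 k).
have JE u v : d (J u) v = om u v by exact: (row_dot_riesz (linear_of (om_lin u))).
have JP c u v : J (c *: u + v) = c *: J u + J v.
  by apply/rowP => k; rewrite !mxE omP1.
have etJ u : et (J u) = 0 by rewrite /et JE omZ.
have dzJ u : d z (J u) = 0 by rewrite dotC; exact: etJ.
have etP c u v : et (c *: u + v) = c * et u + et v by rewrite /et dotDl dotZl.
have etz : et z = 1 by exact: zz.
pose nb u v := 2^-1 *: (om u v *: z - et v *: J u - et u *: J v).
have nb_bil : bilinear_for *:%R *:%R nb.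
  split=> w c u v; apply/rowP => k;
  by rewrite /nb ?omP1 ?omP2 JP etP !mxE; ring.
have nbE u v w : d (nb u v) w = 2^-1 * (om u v * et w - et v * om u w - et u * om v w).
  by rewrite /nb dotZl !dotBl !dotZl !JE /et (dotC d z).
exists (bilinear_of nb_bil),
  (fun u v w => et u * om v w + et v * om w u + et w * om u v); split.
- split=> [u v|u v w].
    rewrite [RHS]brE -/(om u v).
    by apply/rowP => k; rewrite /= /nb (omC v) !mxE; field.
  have := nbE u v w; have := nbE u w v; rewrite (dotC d _ v) => E1 E2.
  by rewrite [LHS](congr2 +%R E2 E1) (omC w v); ring.
- have om_nb u v w :
    om (nb u v) w = 2^-1 * (et v * d (J u) (J w) + et u * d (J v) (J w)).
    rewrite omC -JE /nb dotZr !dotBr !dotZr !(dotC d (J w)).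
    by rewrite dzJ; ring.
  have et_nb u v : et (nb u v) = 2^-1 * om u v by rewrite /et nbE etz !omZ; ring.
  split=> [|y u w] /=.
    split=> [v w c u u'|u v w|u w].
    + by rewrite etP omP1 omP2; ring.
    + by ring.
    + by rewrite omU (omC u w); ring.
  rewrite !(omC _ (nb _ _)) !om_nb !et_nb (dotC d (J w) (J y)) (dotC d (J u) (J y)).
  rewrite (dotC d (J w) (J u)) omU (omC w y); ring.
- exists z, x0, y0; rewrite etz omZ omZ' !mulr0 !addr0 mul1r.
  apply: contra nz => /eqP om0; rewrite brE.
  by rewrite (om0 : row_dot (lie_br n x0 y0) z = 0) scale0r.
Qed.

Lemma heisenberg_killing3 l : (0 < l)%N -> standard_killing3 (heisenberg R l).
Proof.
case: l => // l _.
pose z : 'rV[R]_(l.+1 + l.+1 + 1) := row_mx 0 (1%:M).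
have dz (x : 'rV[R]_(l.+1 + l.+1)) (c : 'M[R]_1) : row_dot (row_mx x c) z = c 0 0.
  rewrite row_dot_mx /row_dot big1 ?add0r => [|i _]; last by rewrite mxE mulr0.
  by rewrite big_ord1 mxE mulr1.
apply: (@contact_killing3 (heisenberg R l.+1) z).
- by rewrite dz mxE.
- move=> x; rewrite /= /heisenberg_br row_mxKl !linear0 mul0mx subrr.
  exact: row_mx0.
- move=> x y; rewrite /= {2}/heisenberg_br dz /heisenberg_br scale_row_mx scaler0.
  by rewrite scalemx1 -mx11_scalar.
- exists (row_mx (row_mx (delta_mx 0 0) 0) 0), (row_mx (row_mx 0 (delta_mx 0 0)) 0).
  apply/eqP => /(congr1 (fun u => row_dot u z)) /=.
  rewrite /heisenberg_br dz !row_mxKl !row_mxKr trmx0 mulmx0 subr0.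
  rewrite trmx_delta mul_delta_mx mxE eqxx /row_dot big1 => [/eqP|i _].
    by rewrite oner_eq0.
  by rewrite mxE mul0r.
Qed.

Definition row6 (a b c d e f : R) : 'rV[R]_6 := \row_k nth 0 [:: a; b; c; d; e; f] k.

Lemma row6E a b c d e f k : (k < 6)%N ->
  row6 a b c d e f 0 (inord k) = nth 0 [:: a; b; c; d; e; f] k.
Proof. by move=> k6; rewrite mxE inordK. Qed.

Lemma row6_eta (x : 'rV[R]_6) : x = row6 (x 0 (inord 0)) (x 0 (inord 1))
  (x 0 (inord 2)) (x 0 (inord 3)) (x 0 (inord 4)) (x 0 (inord 5)).
Proof.
apply/rowP => k; rewrite mxE -[in LHS](inord_val k).
by case: k => [[|[|[|[|[|[|]]]]]]].
Qed.

Lemma row_dot6 a b c d e f a' b' c' d' e' f' :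
  row_dot (row6 a b c d e f) (row6 a' b' c' d' e' f')
  = a * a' + b * b' + c * c' + d * d' + e * e' + f * f'.
Proof. by rewrite /row_dot !big_ord_recl big_ord0 !mxE /= addr0 !addrA. Qed.

Lemma row6P t a b c d e f a' b' c' d' e' f' :
  t *: row6 a b c d e f + row6 a' b' c' d' e' f' = row6 (t * a + a')
    (t * b + b') (t * c + c') (t * d + d') (t * e + e') (t * f + f').
Proof.
by apply/rowP => -[[|[|[|[|[|[|]]]]]] //= i]; rewrite !mxE.
Qed.

Lemma n32_br6 a b c d e f a' b' c' d' e' f' :
  n32_br (row6 a b c d e f) (row6 a' b' c' d' e' f')
  = row6 0 0 0 (a * b' - b * a') (a * c' - c * a') (b * c' - c * b').
Proof.
rewrite /n32_br !row6E //=; apply/rowP => k; rewrite !mxE -!val_eqE /= !inordK //.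
by case: k => [[|[|[|[|[|[|]]]]]]] //= i; ring.
Qed.

Lemma row6Z t a b c d e f :
  t *: row6 a b c d e f = row6 (t * a) (t * b) (t * c) (t * d) (t * e) (t * f).
Proof. by apply/rowP => -[[|[|[|[|[|[|]]]]]] //= i]; rewrite !mxE. Qed.

Lemma row6_ind (P : 'rV[R]_6 -> Prop) :
  (forall a b c d e f, P (row6 a b c d e f)) -> forall x, P x.
Proof. by move=> H x; rewrite [x]row6_eta. Qed.

Definition n32_nab (u v : 'rV[R]_6) : 'rV[R]_6 :=
  let x k := u 0 (inord k) in let y k := v 0 (inord k) in
  2^-1 *: row6
   (y 3 * x 1 + y 4 * x 2 + x 3 * y 1 + x 4 * y 2)
   (- (y 3 * x 0) + y 5 * x 2 - x 3 * y 0 + x 5 * y 2)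
   (- (y 4 * x 0) - y 5 * x 1 - x 4 * y 0 - x 5 * y 1)
   (x 0 * y 1 - x 1 * y 0) (x 0 * y 2 - x 2 * y 0) (x 1 * y 2 - x 2 * y 1).

(** The cyclic sum of <u, [v, w]> and the volume form of the centre both fail
    the Killing equation; the defect of the first is minus twice the defect of the
    second. *)
Definition n32_form (u v w : 'rV[R]_6) : R :=
  let x k := u 0 (inord k) in let y k := v 0 (inord k) in
  let z k := w 0 (inord k) in
  row_dot u (n32_br v w) + row_dot v (n32_br w u) + row_dot w (n32_br u v)
  + 2 * (x 3 * (y 4 * z 5 - y 5 * z 4) - x 4 * (y 3 * z 5 - y 5 * z 3)
         + x 5 * (y 3 * z 4 - y 4 * z 3)).

Lemma free_two_step_3_killing3 : standard_killing3 (free_two_step_3 R).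
Proof.
have nab_bil : bilinear_for *:%R *:%R n32_nab.
  split=> w c u v; apply/rowP => k; rewrite /n32_nab !mxE.
    by case: k => [[|[|[|[|[|[|]]]]]]] //= i; ring.
  by case: k => [[|[|[|[|[|[|]]]]]]] //= i; ring.
exists (bilinear_of nab_bil), n32_form; split.
- split=> [u v|u v w] /=.
    elim/row6_ind: u => u0 u1 u2 u3 u4 u5; elim/row6_ind: v => v0 v1 v2 v3 v4 v5.
    rewrite n32_br6 /n32_nab !row6E //= !row6Z.
    rewrite -[- row6 _ _ _ _ _ _]scaleN1r addrC row6P.
    by congr row6; field.
  elim/row6_ind: u => u0 u1 u2 u3 u4 u5; elim/row6_ind: v => v0 v1 v2 v3 v4 v5.
  elim/row6_ind: w => w0 w1 w2 w3 w4 w5.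
  by rewrite /n32_nab !row6E //= !row6Z !row_dot6; field.
- split=> [|y u w].
    split=> [v w c u u'|u v w|u w].
    + elim/row6_ind: u => u0 u1 u2 u3 u4 u5; elim/row6_ind: v => v0 v1 v2 v3 v4 v5.
      elim/row6_ind: w => w0 w1 w2 w3 w4 w5.
      elim/row6_ind: u' => x0 x1 x2 x3 x4 x5.
      by rewrite /n32_form row6P !n32_br6 !row6E //= !row_dot6; ring.
    + elim/row6_ind: u => u0 u1 u2 u3 u4 u5; elim/row6_ind: v => v0 v1 v2 v3 v4 v5.
      elim/row6_ind: w => w0 w1 w2 w3 w4 w5.
      by rewrite /n32_form !n32_br6 !row6E //= !row_dot6; ring.
    + elim/row6_ind: u => u0 u1 u2 u3 u4 u5.
      elim/row6_ind: w => w0 w1 w2 w3 w4 w5.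
      by rewrite /n32_form !n32_br6 !row6E //= !row_dot6; ring.
  elim/row6_ind: u => u0 u1 u2 u3 u4 u5; elim/row6_ind: w => w0 w1 w2 w3 w4 w5.
  elim/row6_ind: y => y0 y1 y2 y3 y4 y5 /=.
  rewrite /n32_nab !row6E //= !row6Z.
  by rewrite /n32_form !n32_br6 !row6E //= !row_dot6; field.
- exists (row6 1 0 0 0 0 0), (row6 0 1 0 0 0 0), (row6 0 0 0 1 0 0).
  by rewrite /n32_form !n32_br6 !row_dot6 !row6E //=;
    rewrite !(mulr0, mul0r, mulr1, subr0, addr0, add0r, subrr) oner_neq0.
Qed.

End StandardModels.

(** * Isomorphisms and invariants *)

Section LieIso.
Variable R : realType.
Implicit Types n m : lie_algebra R.

Lemma lie_iso_sym n m : lie_iso n m -> lie_iso m n.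
Proof.
case=> f [[g fK gK] fbr].
have g_lin : linear g by move=> c u v; apply: (can_inj fK); rewrite linearP !gK.
exists (linear_of g_lin); split; first by exists f.
by move=> x y /=; apply: (can_inj fK); rewrite fbr !gK.
Qed.

Lemma lie_iso_trans n m (k : lie_algebra R) : lie_iso n m -> lie_iso m k -> lie_iso n k.
Proof.
case=> f [fbij fbr] [g [gbij gbr]].
have gf_lin : linear (g \o f) by move=> c u v /=; rewrite !linearP.
exists (linear_of gf_lin); split; first exact: bij_comp.
by move=> x y /=; rewrite fbr gbr.
Qed.

Lemma lie_iso_dim_le n m : lie_iso n m -> (lie_dim n <= lie_dim m)%N.
Proof.
case=> f [[g fK _] _]; suff /eqP <- : row_free (lin1_mx f) by exact: rank_leq_col.
apply: inj_row_free => v; rewrite mul_rV_lin1 => fv0.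
by rewrite -(fK v) -(fK 0) raddf0 fv0.
Qed.

Lemma lie_iso_dim n m : lie_iso n m -> lie_dim n = lie_dim m.
Proof.
move=> nm; apply/eqP; rewrite eqn_leq lie_iso_dim_le //.
exact/lie_iso_dim_le/lie_iso_sym.
Qed.

Lemma lie_iso_two_step n m :
  lie_iso n m -> two_step_nilpotent m -> two_step_nilpotent n.
Proof.
case=> f [[g fK gK] fbr] [[x [y xy]] m2]; split.
  exists (g x), (g y); apply: contra xy => /eqP gxy.
  by rewrite -[x]gK -[y]gK -fbr gxy raddf0.
by move=> u v w; apply: (can_inj fK); rewrite !fbr m2 raddf0.
Qed.

Lemma heisenberg_two_step l : (0 < l)%N -> two_step_nilpotent (heisenberg R l).
Proof.
move=> l0; split.
  exists (row_mx (row_mx (delta_mx 0 (Ordinal l0)) 0) 0).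
  exists (row_mx (row_mx 0 (delta_mx 0 (Ordinal l0))) 0).
  apply/eqP => /(congr1 (fun u => rsubmx u 0 0)).
  rewrite /= /heisenberg_br !row_mxKl !row_mxKr trmx0 mulmx0 subr0.
  rewrite trmx_delta mul_delta_mx linear0 !mxE eqxx /= => /eqP.
  by rewrite oner_eq0.
move=> x y z; rewrite /= /heisenberg_br row_mxKl !linear0 mul0mx addr0.
by rewrite row_mx0.
Qed.

Lemma lie_dsum_two_step n m :
  (forall x y z, lie_br n (lie_br n x y) z = 0) ->
  two_step_nilpotent m -> two_step_nilpotent (lie_dsum n m).
Proof.
move=> n2 [[x [y xy]] m2]; split.
  exists (row_mx 0 x), (row_mx 0 y); apply: contra xy => /eqP.
  move=> /(congr1 (@rsubmx _ _ (lie_dim n) _)); rewrite /= /dsum_br !row_mxKr linear0.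
  by move=> ->.
by move=> u v w; rewrite /= /dsum_br !row_mxKl !row_mxKr n2 m2 row_mx0.
Qed.

Lemma free_two_step_3_two_step : two_step_nilpotent (free_two_step_3 R).
Proof.
split.
  exists (row6 1 0 0 0 0 0), (row6 0 1 0 0 0 0); rewrite /= n32_br6.
  apply/eqP => /(congr1 (fun u : 'rV_6 => u 0 (inord 3))).
  by rewrite row6E // mxE /= mulr1 mulr0 subr0 => /eqP; rewrite oner_eq0.
move=> x y z /=; elim/row6_ind: x => *; elim/row6_ind: y => *.
elim/row6_ind: z => *; rewrite !n32_br6 !(mul0r, subrr, mulr0).
by apply/rowP => -[[|[|[|[|[|[|]]]]]] //= i]; rewrite !mxE.
Qed.

(** Two isomorphism invariants that separate the models of equal dimension:
    the derived algebra is at most a line, respectively every 2-form obtained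
    by composing the bracket with a linear form satisfies the Pluecker relation. *)
Definition derived_line n := exists z, forall x y, exists c, lie_br n x y = c *: z.

Definition decomposable_bracket n :=
  forall (phi : {linear 'rV[R]_(lie_dim n) -> R}) x y z w,
  let om u v := phi (lie_br n u v) in
  om x y * om z w - om x z * om y w + om x w * om y z = 0.

Lemma derived_line_iso n m : lie_iso n m -> derived_line m -> derived_line n.
Proof.
case=> f [[g fK gK] fbr] [z mz]; exists (g z) => x y.
have [c mxy] := mz (f x) (f y); exists c.
by apply: (can_inj fK); rewrite fbr mxy linearZ /= gK.
Qed.

Lemma decomposable_bracket_iso n m :
  lie_iso n m -> decomposable_bracket m -> decomposable_bracket n.
Proof.
case=> f [[g fK gK] fbr] mD phi x y z w.
have phig_lin : linear (phi \o g).
  move=> c u v /=; rewrite (_ : g _ = c *: g u + g v) ?linearP //.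
  by apply: (can_inj fK); rewrite linearP !gK.
have := mD (linear_of phig_lin) (f x) (f y) (f z) (f w).
by rewrite /= -!fbr !fK.
Qed.

Lemma heisenberg_derived_line l : derived_line (heisenberg R l).
Proof.
exists (row_mx 0 1%:M) => x y; exists (rsubmx (heisenberg_br x y) 0 0).
by rewrite /= /heisenberg_br row_mxKr scale_row_mx scaler0 scalemx1 -mx11_scalar.
Qed.

Lemma abelian_sum_derived_line k n :
  derived_line n -> derived_line (lie_dsum (abelian R k) n).
Proof.
case=> z nz; exists (row_mx 0 z) => x y.
have [c nc] := nz (rsubmx x) (rsubmx y); exists c.
by rewrite /= /dsum_br nc scale_row_mx scaler0.
Qed.

Lemma abelian_sum_decomposable k n :
  decomposable_bracket n <-> decomposable_bracket (lie_dsum (abelian R k) n).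
Proof.
split=> H phi x y z w.
  have phi_lin : linear (fun u => phi (row_mx 0 u)).
    move=> c u v; rewrite -linearP; congr (phi _).
    by rewrite scale_row_mx add_row_mx scaler0 addr0.
  exact: (H (linear_of phi_lin) (rsubmx x) (rsubmx y) (rsubmx z) (rsubmx w)).
have phi_lin : linear (fun u : 'rV_(k + lie_dim n) => phi (rsubmx u)).
  by move=> c u v; rewrite !linearP.
have := H (linear_of phi_lin) (row_mx 0 x) (row_mx 0 y) (row_mx 0 z) (row_mx 0 w).
by rewrite /= /dsum_br !row_mxKr.
Qed.

Lemma heisenberg1_decomposable : decomposable_bracket (heisenberg R 1).
Proof.
move=> phi x y z w om.
have omE u v : om u v = (u 0 (lshift 1 (lshift 1 0)) * v 0 (lshift 1 (rshift 1 0))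
    - v 0 (lshift 1 (lshift 1 0)) * u 0 (lshift 1 (rshift 1 0)))
    * phi (row_mx 0 1%:M).
  rewrite -[RHS]/(_ *: _) -linearZ; congr (phi _) => /=; rewrite /heisenberg_br.
  rewrite scale_row_mx scaler0; congr row_mx; rewrite scalemx1 [LHS]mx11_scalar.
  by congr (_%:M); rewrite !mxE !big_ord1 !mxE.
by rewrite !omE; ring.
Qed.

Lemma free_two_step_3_decomposable : decomposable_bracket (free_two_step_3 R).
Proof.
move=> phi x y z w om.
have omE u v : om u v = n32_br u v 0 (inord 3) * phi (delta_mx 0 (inord 3))
  + n32_br u v 0 (inord 4) * phi (delta_mx 0 (inord 4))
  + n32_br u v 0 (inord 5) * phi (delta_mx 0 (inord 5)).
  rewrite -![_ * phi _]/(_ *: _) -!linearZ -!raddfD; congr (phi _).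
  elim/row6_ind: u => *; elim/row6_ind: v => *; rewrite /= n32_br6 !row6E //=.
  apply/rowP => -[[|[|[|[|[|[|]]]]]] //= i]; rewrite !mxE -!val_eqE /= !inordK //=; ring.
rewrite !omE.
elim/row6_ind: x => *; elim/row6_ind: y => *; elim/row6_ind: z => *.
by elim/row6_ind: w => *; rewrite !n32_br6 !row6E //=; ring.
Qed.

Lemma heisenberg_br_row l (a b a' b' : 'rV[R]_l) c c' :
  heisenberg_br (row_mx (row_mx a b) c) (row_mx (row_mx a' b') c')
  = row_mx 0 (a *m b'^T - a' *m b^T).
Proof. by rewrite /heisenberg_br !row_mxKl !row_mxKr. Qed.

Lemma heisenberg2_not_decomposable : ~ decomposable_bracket (heisenberg R 2).
Proof.
have phi_lin : linear (fun u : 'rV[R]_(2 + 2 + 1) => u 0 (rshift _ 0)).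
  by move=> c u v; rewrite !mxE.
pose e (i : 'I_2) : 'rV[R]_(2 + 2 + 1) := row_mx (row_mx (delta_mx 0 i) 0) 0.
pose f (i : 'I_2) : 'rV[R]_(2 + 2 + 1) := row_mx (row_mx 0 (delta_mx 0 i)) 0.
move=> /(_ (linear_of phi_lin) (e 0) (f 0) (e 1) (f 1)) /=.
rewrite /e /f !heisenberg_br_row !row_mxEr !trmx0 !mulmx0 !mul0mx.
rewrite !trmx_delta !mul_delta_mx_cond !mxE /=.
rewrite !(subr0, sub0r, mulr0n, mulr1n, oppr0, mul0r, mulr0, addr0, mulr1) => /eqP.
by rewrite oner_eq0.
Qed.

Lemma not_derived_line n x y x' y' i j :
  lie_br n x y 0 i != 0 -> lie_br n x y 0 j = 0 -> lie_br n x' y' 0 j != 0 ->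
  ~ derived_line n.
Proof.
move=> + + + [z nz]; have [c ->] := nz x y; have [c' ->] := nz x' y'.
rewrite !mxE mulf_eq0 negb_or => /andP[c0 _] /eqP.
by rewrite mulf_eq0 (negbTE c0) /= => /eqP ->; rewrite mulr0 eqxx.
Qed.

Section SumOfNonAbelian.
Variables (n m : lie_algebra R) (x y : 'rV[R]_(lie_dim n)) (x' y' : 'rV[R]_(lie_dim m)).
Variables (i : 'I_(lie_dim n)) (j : 'I_(lie_dim m)).
Hypotheses (xy : lie_br n x y 0 i != 0) (xy' : lie_br m x' y' 0 j != 0).

Let brl (u v : 'rV[R]_(lie_dim n)) :
  lie_br (lie_dsum n m) (row_mx u 0) (row_mx v 0) = row_mx (lie_br n u v) 0.
Proof. by rewrite /= /dsum_br !row_mxKl !row_mxKr linear0l. Qed.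

Let brr (u v : 'rV[R]_(lie_dim m)) :
  lie_br (lie_dsum n m) (row_mx 0 u) (row_mx 0 v) = row_mx 0 (lie_br m u v).
Proof. by rewrite /= /dsum_br !row_mxKl !row_mxKr linear0l. Qed.

Let brlr (u : 'rV[R]_(lie_dim n)) (v : 'rV[R]_(lie_dim m)) :
  lie_br (lie_dsum n m) (row_mx u 0) (row_mx 0 v) = 0.
Proof. by rewrite /= /dsum_br !row_mxKl !row_mxKr linear0l linear0r row_mx0. Qed.

Lemma lie_dsum_not_decomposable : ~ decomposable_bracket (lie_dsum n m).
Proof.
have phi_lin : linear (fun u : 'rV[R]_(lie_dim n + lie_dim m) =>
    u 0 (lshift (lie_dim m) i) + u 0 (rshift (lie_dim n) j)).
  by move=> c u v; rewrite !mxE /GRing.scale /=; ring.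
move=> /(_ (linear_of phi_lin) (row_mx x 0) (row_mx y 0) (row_mx 0 x') (row_mx 0 y')).
cbv beta zeta; rewrite brl brr !brlr !linear0 !mulr0 subr0 addr0 => /eqP.
rewrite /= !row_mxEl !row_mxEr ?mxE ?addr0 ?add0r.
by rewrite mulf_eq0 (negbTE xy) (negbTE xy').
Qed.

Lemma lie_dsum_not_derived_line : ~ derived_line (lie_dsum n m).
Proof.
apply: (@not_derived_line (lie_dsum n m) (row_mx x 0) (row_mx y 0)
  (row_mx 0 x') (row_mx 0 y') (lshift (lie_dim m) i) (rshift (lie_dim n) j)).
- by rewrite brl row_mxEl.
- by rewrite brl row_mxEr mxE.
- by rewrite brr row_mxEr.
Qed.

End SumOfNonAbelian.

Lemma heisenberg1_unit_bracket :
  exists e f, lie_br (heisenberg R 1) e f 0 (rshift 2 0) != 0.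
Proof.
exists (row_mx (row_mx 1%:M 0) 0), (row_mx (row_mx 0 1%:M) 0).
rewrite /= heisenberg_br_row !mul0mx trmx1 mulmx1 subr0 row_mxEr mxE.
exact: oner_neq0.
Qed.

Lemma free_two_step_3_not_derived_line : ~ derived_line (free_two_step_3 R).
Proof.
apply: (@not_derived_line (free_two_step_3 R) (row6 1 0 0 0 0 0) (row6 0 1 0 0 0 0)
  (row6 1 0 0 0 0 0) (row6 0 0 1 0 0 0) (inord 3) (inord 4));
by rewrite /= n32_br6 row6E //= ?mulr1 ?mulr0 ?subr0 ?oner_neq0.
Qed.

End LieIso.

(** * Darboux bases *)

Section LinearAlgebra.
Variable R : realType.

(** Admitting zero rows fixes the number of rows, which avoids casts along
    equations between ranks. *)
Lemma padded_basis r m p (U : 'M[R]_(m, p)) :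
  (\rank U <= r)%N -> exists B : 'M[R]_(r, p), (B :=: U)%MS.
Proof.
move=> Ur; exists (@pid_mx R r (\rank U) (\rank U) *m row_base U).
apply: eqmx_trans (eqmxMfull _ _) (eq_row_base U).
by rewrite /row_full rank_pid_mx.
Qed.

Lemma skew_form_eq0 p (O : 'M[R]_p) (x : 'rV_p) : O^T = - O -> x *m O *m x^T = 0.
Proof.
move=> skewO; set a := x *m O *m x^T.
have aT : a^T = - a by rewrite /a !trmx_mul trmxK skewO mulNmx mulmxN mulmxA.
move: (a) aT => {}a /(congr1 (fun M : 'M[R]_1 => M 0 0)); rewrite !mxE => a0.
by rewrite [a]mx11_scalar (_ : a 0 0 = 0) ?raddf0 //; lra.
Qed.

Lemma skew_formC p q r (O : 'M[R]_p) (X : 'M[R]_(q, p)) (Y : 'M[R]_(r, p)) :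
  O^T = - O -> X *m O *m Y^T = - (Y *m O *m X^T)^T.
Proof. by move=> skewO; rewrite !trmx_mul trmxK skewO mulNmx mulmxN opprK mulmxA. Qed.

Lemma row_form p m (O : 'M[R]_p) (U : 'M[R]_(m, p)) i j :
  (row i U *m O *m (row j U)^T) 0 0 = (U *m O *m U^T) i j.
Proof.
rewrite -row_mul mxE [RHS]mxE; apply: eq_bigr => k _.
by rewrite [row _ _ _ _]mxE [(row _ _)^T _ _]mxE [row _ _ _ _]mxE [U^T _ _]mxE.
Qed.

Lemma orthogonal_sub p m q r (C : 'M[R]_(r, p)) (O : 'M[R]_p) (U : 'M[R]_(m, p))
    (M : 'M[R]_(q, p)) :
  (U <= M)%MS -> C *m O *m M^T = 0 -> C *m O *m U^T = 0.
Proof. by case/submxP=> N -> H; rewrite trmx_mul mulmxA H mul0mx. Qed.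

(** Two vectors of U with product 1 span a hyperbolic plane; the vectors of U
    orthogonal to it form a complement of smaller rank. *)
Lemma darboux p m (U : 'M[R]_(m, p)) (O : 'M[R]_p) : O^T = - O ->
  exists l k (A B : 'M[R]_(l, p)) (C : 'M[R]_(k, p)),
    [/\ row_free C, (A + B + C :=: U)%MS,
        A *m O *m A^T = 0 /\ B *m O *m B^T = 0, A *m O *m B^T = 1%:M
      & C *m O *m U^T = 0].
Proof.
move=> skewO.
suff H r : forall q (U : 'M[R]_(q, p)), (\rank U < r)%N ->
  exists l k (A B : 'M[R]_(l, p)) (C : 'M[R]_(k, p)),
    [/\ row_free C, (A + B + C :=: U)%MS,
        A *m O *m A^T = 0 /\ B *m O *m B^T = 0, A *m O *m B^T = 1%:M
      & C *m O *m U^T = 0] by exact: (H (\rank U).+1).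
elim: r => // r IH {m}q {}U rU.
have [U0|] := eqVneq (U *m O *m U^T) 0.
  exists 0, (\rank U), 0, 0, (row_base U); split.
  - exact: row_base_free.
  - apply: eqmx_trans (adds_eqmx (adds0mx _ _) (eqmx_refl _)) _.
    exact: eqmx_trans (adds0mx _ _) (eq_row_base U).
  - by rewrite !mul0mx.
  - by apply/matrixP => -[].
  - have /submxP[N ->] : (row_base U <= U)%MS by rewrite eq_row_base.
    by rewrite -!mulmxA (mulmxA U) U0 mulmx0.
case/matrix0Pn=> i [j]; set c := (_ *m _) i j => c0.
pose x := row i U; pose y := c^-1 *: row j U.
have xy : x *m O *m y^T = 1%:M.
  by rewrite /y linearZ /= -scalemxAr [_ *m _]mx11_scalar row_form scale_scalar_mx mulVf.
have xU : (x <= U)%MS by exact: row_sub.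
have yU : (y <= U)%MS by exact: scalemx_sub (row_sub _ _).
clearbody x y.
pose U' := (U :&: kermx (O *m (col_mx x y)^T))%MS.
have U'x : U' *m O *m x^T = 0 /\ U' *m O *m y^T = 0.
  have : U' *m (O *m (col_mx x y)^T) = 0 by apply/sub_kermxP; exact: capmxSr.
  rewrite tr_col_mx mul_mx_row mul_mx_row => /eqP.
  by rewrite row_mx_eq0 !mulmxA => /andP[/eqP ? /eqP ?].
have U'U : (U' <= U)%MS by exact: capmxSl.
have rU' : (\rank U' < r)%N.
  rewrite -ltnS; apply: leq_trans rU; rewrite ltnS; apply: rank_ltmx.
  rewrite ltmxE U'U /=; apply/negP => UU'.
  have /submxP[N xN] := submx_trans xU UU'.
  have /matrixP/(_ 0 0)/eqP : 1%:M = 0 :> 'M[R]_1.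
    by rewrite -xy xN -!mulmxA (mulmxA U') U'x.2 mulmx0.
  by rewrite !mxE eqxx oner_eq0.
have UE : (x + y + U' :=: U)%MS.
  apply/eqmxP; rewrite !addsmx_sub xU yU U'U /=; apply/row_subP => i'.
  set u := row i' U; have uU : (u <= U)%MS by exact: row_sub.
  set a := (u *m O *m y^T) 0 0; set b := (u *m O *m x^T) 0 0.
  rewrite -[u](subrK (a *: x + (- b) *: y)) addrC.
  apply: addmx_sub_adds.
    by apply: addmx_sub_adds; exact: scalemx_sub (submx_refl _).
  rewrite sub_capmx; apply/andP; split.
    apply: addmx_sub uU _; rewrite eqmx_opp.
    by apply: addmx_sub; [exact: scalemx_sub xU | exact: scalemx_sub yU].
  apply/sub_kermxP; rewrite tr_col_mx mul_mx_row mul_mx_row !mulmxA.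
  rewrite !(mulmxDl, mulNmx) -!scalemxAl !skew_form_eq0 // xy.
  rewrite (skew_formC y x) // xy trmx1 !scaler0 addr0 add0r.
  rewrite scaleNr scalerN opprK !scalemx1 -!mx11_scalar !subrr.
  exact: row_mx0.
have [l [k [A [B [C [Cfree E [AA BB] AB CU]]]]]] := IH _ U' rU'.
have CU' : (C <= U')%MS by rewrite -E addsmxSr.
have AU' : (A <= U')%MS by rewrite -E -addsmxA addsmxSl.
have BU' : (B <= U')%MS by rewrite -E (addsmxC A) -addsmxA addsmxSl.
have orth q' (M : 'M[R]_(q', p)) : (M <= U')%MS -> M *m O *m x^T = 0 /\ M *m O *m y^T = 0.
  by case/submxP=> N ->; rewrite -!mulmxA !(mulmxA U') !U'x.1 !U'x.2 !mulmx0.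
have orth' q' (M : 'M[R]_(q', p)) : (M <= U')%MS -> x *m O *m M^T = 0 /\ y *m O *m M^T = 0.
  by case/orth=> Mx My; rewrite !(skew_formC _ M) // Mx My trmx0 oppr0.
exists (1 + l)%N, k, (col_mx x A), (col_mx y B), C; split=> //.
- have xA : (x <= col_mx x A)%MS /\ (A <= col_mx x A)%MS.
    by rewrite -!addsmxE addsmxSl addsmxSr.
  have yB : (y <= col_mx y B)%MS /\ (B <= col_mx y B)%MS.
    by rewrite -!addsmxE addsmxSl addsmxSr.
  apply/eqmxP/andP; split.
    by rewrite !addsmx_sub !col_mx_sub xU yU !(submx_trans _ U'U).
  rewrite -UE !addsmx_sub -E !addsmx_sub addsmxSr andbT.
  rewrite !(submx_trans _ (addsmxSl _ C)) ?addsmxSl //;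
    do ?[by rewrite (submx_trans xA.1) ?(submx_trans xA.2) ?addsmxSl];
    by [apply: submx_trans xA.1 _; exact: addsmxSl
       |apply: submx_trans xA.2 _; exact: addsmxSl
       |apply: submx_trans yB.1 _; exact: addsmxSr
       |apply: submx_trans yB.2 _; exact: addsmxSr].
- rewrite !tr_col_mx !mul_col_mx !mul_mx_row !skew_form_eq0 // AA BB.
  rewrite (orth _ _ AU').1 (orth _ _ BU').2 (orth' _ _ AU').1 (orth' _ _ BU').2.
  by rewrite !row_mx0 !col_mx0.
- rewrite tr_col_mx !mul_col_mx !mul_mx_row xy AB (orth _ _ AU').2 (orth' _ _ BU').1.
  exact/esym/scalar_mx_block.
- apply: (@orthogonal_sub _ _ _ _ C O U (col_mx (col_mx x y) U')).
    rewrite -UE !addsmx_sub -!addsmxE addsmxSr.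
    by rewrite !(submx_trans _ (addsmxSl _ U')) // -addsmxE ?addsmxSl ?addsmxSr.
  rewrite !tr_col_mx !mul_mx_row CU (orth _ _ CU').1 (orth _ _ CU').2.
  by rewrite !row_mx0.
Qed.

Lemma lie_iso_of_basis (n m : lie_algebra R) (P : 'M[R]_(lie_dim m, lie_dim n)) :
  row_free P -> row_full P ->
  (forall x y, lie_br n (x *m P) (y *m P) = lie_br m x y *m P) -> lie_iso n m.
Proof.
move=> Pfree Pfull Pbr; apply: lie_iso_sym.
have f_lin : linear (fun x : 'rV[R]_(lie_dim m) => x *m P).
  by move=> c u v; rewrite mulmxDl -scalemxAl.
exists (linear_of f_lin); split=> [|x y] /=; last by rewrite Pbr.
exists (fun y => y *m pinvmx P) => x /=; first by rewrite mulmxKp.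
by rewrite mulmxKpV // submx_full.
Qed.

End LinearAlgebra.

(** * Algebras whose derived algebra is a line *)

Section BracketForm.
Variables (R : realType) (n : lie_algebra R).
Local Notation V := 'rV[R]_(lie_dim n).
Implicit Types u v w x y z : V.

Definition gram_mx p (b : 'rV[R]_p -> 'rV[R]_p -> R) : 'M[R]_p :=
  \matrix_(i, j) b (delta_mx 0 i) (delta_mx 0 j).

Lemma gram_mxE p (b : {bilinear 'rV[R]_p -> 'rV[R]_p -> R}) (u v : 'rV[R]_p) :
  (u *m gram_mx b *m v^T) 0 0 = b u v.
Proof.
rewrite (bilinear_coord b) mxE exchange_big /=; apply: eq_bigr => j _.
rewrite !mxE mulr_suml; apply: eq_bigr => i _; rewrite !mxE.
by rewrite /GRing.scale /=; ring.
Qed.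

(** A Darboux basis of the scalar bracket on a complement of the derived line
    splits that complement into the centre and a symplectic part. *)
Lemma lie_iso_heisenberg_sum : two_step_nilpotent n -> derived_line n ->
  exists k l, (0 < l)%N /\ lie_iso n (lie_dsum (abelian R k) (heisenberg R l)).
Proof.
move=> [[x0 [y0 nz]] n2] [z brz].
have z0 : z != 0.
  by apply: contra nz => /eqP z0; have [c ->] := brz x0 y0; rewrite z0 scaler0.
pose om u v := (row_dot z z)^-1 * row_dot (lie_br n u v) z.
have om_bil : bilinear_for *:%R *:%R om.
  by split=> w c u v; rewrite /om ?linearPl ?linearPr /= row_dotP /GRing.scale /=; ring.
have zz : row_dot z z != 0 by rewrite lt0r_neq0 // row_dot_gt0.
have dot0 : row_dot 0 z = 0 := dot0l (std_dot R _) z.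
have brE u v : lie_br n u v = om u v *: z.
  have [c brc] := brz u v; rewrite /om brc -[c *: z]addr0 row_dotP.
  by rewrite dot0 !addr0 mulrCA mulVf // mulr1.
have zcentral u : lie_br n z u = 0.
  have [c brc] := brz x0 y0.
  have c0 : c != 0 by apply: contra nz => /eqP c0; rewrite brc c0 scale0r.
  apply/eqP; have := n2 x0 y0 u; rewrite brc linearZl_LR => /eqP.
  by rewrite scaler_eq0 (negbTE c0).
pose O := gram_mx om.
have OE u v : u *m O *m v^T = (om u v)%:M.
  by rewrite [LHS]mx11_scalar (gram_mxE (bilinear_map_of om_bil)).
have skewO : O^T = - O.
  apply/matrixP => i j; rewrite !mxE /om (lie_antisym (delta_mx 0 j)).
  by rewrite /row_dot -mulrN -sumrN; congr (_ * _); apply: eq_bigr => k _; rewrite mxE mulNr.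
have zO : z *m O = 0.
  apply/rowP => j; rewrite [RHS]mxE.
  have -> : (z *m O) 0 j = (z *m O *m (delta_mx 0 j : V)^T) 0 0.
    by rewrite trmx_delta -colE [RHS]mxE.
  by rewrite OE /om zcentral dot0 mulr0 mxE mul0rn.
have [l [k [A [B [C [Cfree ABC [AA BB] AB CU]]]]]] := darboux (z^C)%MS skewO.
have CO : C *m O = 0.
  have : C *m O *m (1%:M)^T = 0; last by rewrite trmx1 mulmx1.
  apply: (@orthogonal_sub _ _ _ _ _ C O 1%:M (col_mx (z^C)%MS z)).
    by rewrite -addsmxE addsmxC submx_full // addsmx_compl_full.
  by rewrite tr_col_mx mul_mx_row CU (skew_formC C z) // zO mul0mx trmx0 oppr0 row_mx0.
have BA : B *m O *m A^T = - 1%:M by rewrite skew_formC // AB trmx1.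
have AC : A *m O *m C^T = 0 by rewrite skew_formC // CO mul0mx trmx0 oppr0.
have BC : B *m O *m C^T = 0 by rewrite skew_formC // CO mul0mx trmx0 oppr0.
have Az : A *m O *m z^T = 0 by rewrite skew_formC // zO mul0mx trmx0 oppr0.
have Bz : B *m O *m z^T = 0 by rewrite skew_formC // zO mul0mx trmx0 oppr0.
pose P := col_mx C (col_mx (col_mx A B) z).
have Pfull : row_full P.
  rewrite -sub1mx; apply: (@submx_trans _ _ _ _ _ _ (z + z^C)%MS).
    by rewrite submx_full // addsmx_compl_full.
  have := submx_refl P; rewrite {1}/P !col_mx_sub => /andP[CP /andP[/andP[AP BP] zP]].
  by rewrite addsmx_sub zP -ABC !addsmx_sub AP BP CP.
have comboO (c : 'rV_k) (a b : 'rV_l) (t : 'cV_1) : (c *m C + (a *m A + b *m B + t *m z)) *m O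
    = a *m A *m O + b *m B *m O.
  by rewrite !mulmxDl -(mulmxA c) CO -(mulmxA t) zO !mulmx0 add0r addr0.
have PE (w : 'rV_(k + (l + l + 1))) : w *m P = lsubmx w *m C
    + (lsubmx (lsubmx (rsubmx w)) *m A + rsubmx (lsubmx (rsubmx w)) *m B
       + rsubmx (rsubmx w) *m z).
  rewrite -{1}[w]hsubmxK mul_row_col; congr (_ + _).
  rewrite -{1}[rsubmx w]hsubmxK mul_row_col; congr (_ + _).
  by rewrite -{1}[lsubmx (rsubmx w)]hsubmxK mul_row_col.
have Pfree : row_free P.
  apply: inj_row_free => v; rewrite PE.
  set c := lsubmx v; set a := lsubmx (lsubmx _); set b := rsubmx (lsubmx _).
  set t := rsubmx (rsubmx v) => v0.
  have abO : a *m A *m O + b *m B *m O = 0 by rewrite -(comboO c a b t) v0 mul0mx.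
  have a0 : a = 0.
    have := congr1 (mulmxr B^T) abO.
    by rewrite /= mulmxDl -!mulmxA !(mulmxA _ O) AB BB mulmx0 addr0 mulmx1 mul0mx.
  have b0 : b = 0.
    have := congr1 (mulmxr A^T) abO.
    rewrite /= mulmxDl -!mulmxA !(mulmxA _ O) AA BA mulmx0 add0r mulmxN mulmx1 mul0mx.
    by move=> /eqP; rewrite oppr_eq0 => /eqP.
  move: v0; rewrite a0 b0 !mul0mx !add0r => ct0.
  have cC0 : c *m C = 0.
    apply/eqP; rewrite -submx0 -(capmx_compl z) sub_capmx; apply/andP; split.
      have -> : c *m C = - (t *m z) by apply/eqP; rewrite -addr_eq0 ct0.
      by rewrite eqmx_opp submxMl.
    by rewrite -ABC; apply: submx_trans (submxMl _ _) (addsmxSr _ _).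
  have c0 : c = 0 by apply: (row_free_inj Cfree); rewrite cC0 mul0mx.
  have t0 : t = 0.
    move: ct0; rewrite cC0 add0r [t]mx11_scalar mul_scalar_mx => /eqP.
    by rewrite scaler_eq0 (negbTE z0) orbF => /eqP ->; rewrite raddf0.
  rewrite -[v]hsubmxK -[rsubmx v]hsubmxK -[lsubmx (rsubmx v)]hsubmxK.
  by rewrite -/a -/b -/c -/t a0 b0 c0 t0 !row_mx0.
have l_gt0 : (0 < l)%N.
  case: (posnP l) => // l0; case/negP: nz; rewrite brE.
  suff O0 : O = 0.
    have := OE x0 y0; rewrite O0 mulmx0 mul0mx => /matrixP/(_ 0 0).
    by rewrite !mxE eqxx mulr1n => <-; rewrite scale0r.
  have A0 : A = 0 by apply/matrixP => i; exfalso; move: (ltn_ord i); rewrite {2}l0.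
  have B0 : B = 0 by apply/matrixP => i; exfalso; move: (ltn_ord i); rewrite {2}l0.
  have PO : P *m O = 0 by rewrite /P !mul_col_mx CO zO A0 B0 !mul0mx !col_mx0.
  have /row_fullP[Q QP] := Pfull.
  by rewrite -(mul1mx O) -QP -mulmxA PO mulmx0.
exists k, l; split=> //.
apply: (@lie_iso_of_basis R n (lie_dsum (abelian R k) (heisenberg R l)) P) => // x y.
rewrite brE -mul_scalar_mx -OE /= /dsum_br /heisenberg_br.
rewrite [in RHS]/P !mul_row_col !mul0mx !add0r; congr (_ *m z).
rewrite !PE comboO !(linearD, mulmxDl, mulmxDr) /= !trmx_mul !mulmxA.
have assoc r s (a : 'rV_r) (M : 'M[R]_(r, lie_dim n)) (N : 'M[R]_(lie_dim n, s)) :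
  a *m M *m O *m N = a *m (M *m O *m N) by rewrite !mulmxA.
rewrite !assoc AC AA AB Az BC BA BB Bz !mulmx0 !mul0mx !addr0 !add0r mulmx1.
congr (_ + _); rewrite mulmxN mulmx1 mulNmx; congr (- _).
rewrite -[RHS]trmxK trmx_mul trmxK; apply/matrixP => i j.
by rewrite [RHS]mxE !ord1.
Qed.


End BracketForm.

(** * The derived algebra *)

Section Derived.
Variables (R : realType) (n : lie_algebra R).
Local Notation V := 'rV[R]_(lie_dim n).
Implicit Types u v w x y z : V.

Definition derived : 'M[R]_(lie_dim n) :=
  (\sum_(ij : 'I_(lie_dim n) * 'I_(lie_dim n))
     <<lie_br n (delta_mx 0 ij.1) (delta_mx 0 ij.2)>>)%MS.

Lemma br_sub_derived x y : (lie_br n x y <= derived)%MS.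
Proof.
rewrite bilinear_coord; apply: summx_sub => i _; apply: summx_sub => j _.
by apply: scalemx_sub; apply: (sumsmx_sup (i, j)) => //; rewrite genmxE.
Qed.

Lemma derived_sub m (M : 'M[R]_(m, lie_dim n)) :
  (forall x y, (lie_br n x y <= M)%MS) -> (derived <= M)%MS.
Proof. by move=> H; apply/sumsmx_subP => ij _; rewrite genmxE. Qed.

Lemma derived_line_of_rank : (\rank derived <= 1)%N -> derived_line n.
Proof.
case/padded_basis=> z ez; exists z => x y.
by have := br_sub_derived x y; rewrite -ez => /sub_rVP.
Qed.

Hypothesis n2 : two_step_nilpotent n.

Lemma derived_central u v : (u <= derived)%MS -> lie_br n u v = 0.
Proof.
move=> uD; have f_lin : linear (fun w => lie_br n w v).
  by move=> c x y; rewrite linearPl.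
have : (derived <= kermx (lin1_mx (linear_of f_lin)))%MS.
  by apply: derived_sub => x y; apply/sub_kermxP; rewrite mul_rV_lin1; exact: (proj2 n2).
by move=> /(submx_trans uD)/sub_kermxP; rewrite mul_rV_lin1.
Qed.

(** Brackets are central, so only the components in a complement of the derived
    algebra contribute. *)
Lemma br_complement m (E : 'M[R]_(m, lie_dim n)) : (derived^C <= E)%MS ->
  forall x y, exists w w' : 'rV_m, lie_br n x y = lie_br n (w *m E) (w' *m E).
Proof.
move=> DE; suff H x : exists w : 'rV_m, forall y, lie_br n x y = lie_br n (w *m E) y.
  move=> x y; have [w wE] := H x; have [w' wE'] := H y; exists w, w'.
  by rewrite wE lie_antisym wE' -lie_antisym.
have : (x <= derived + derived^C)%MS by rewrite submx_full // addsmx_compl_full.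
case/sub_addsmxP=> -[a b] ->.
have /submxP[w ->] := submx_trans (submxMl b (derived^C)%MS) DE.
exists w => y; rewrite linearDl derived_central ?add0r //=; exact: submxMl.
Qed.

Lemma br_mulmx m (E : 'M[R]_(m, lie_dim n)) (w w' : 'rV_m) :
  lie_br n (w *m E) (w' *m E)
  = \sum_i \sum_j (w 0 i * w' 0 j) *: lie_br n (row i E) (row j E).
Proof.
rewrite !mulmx_sum_row linear_sumlz; apply: eq_bigr => i _.
rewrite linear_sumr; apply: eq_bigr => j _.
by rewrite linearZl_LR linearZr_LR scalerA mulrC.
Qed.

(** Two generators have a single bracket. *)
Lemma derived_line_of_corank : (lie_dim n - \rank derived <= 2)%N -> derived_line n.
Proof.
rewrite -mxrank_compl => /padded_basis[E eE].
exists (lie_br n (row 0 E) (row 1 E)) => x y.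
have [|w [w' ->]] := br_complement (E := E) _ x y; first by rewrite eE.
exists (w 0 0 * w' 0 1 - w 0 1 * w' 0 0).
rewrite br_mulmx !big_ord_recl !big_ord0 !addr0 !lie_alt !scaler0 addr0 add0r.
rewrite (_ : lift ord0 ord0 = 1); last exact: val_inj.
by rewrite (lie_antisym (row 1 E)) scalerN -scalerBl.
Qed.

(** Three generators and a derived algebra of dimension at least three leave no
    relation among the brackets of the generators. *)
Lemma lie_iso_free_two_step_3 : ~ derived_line n -> (lie_dim n <= 6)%N ->
  (3 <= \rank derived)%N -> lie_iso n (free_two_step_3 R).
Proof.
move=> nline p6 d3.
have q3 : (3 <= lie_dim n - \rank derived)%N.
  by rewrite ltnNge; apply/negP => /derived_line_of_corank.
have pE : lie_dim n = 6 by lia.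
have [E eE] : exists E : 'M[R]_(3, lie_dim n), (E :=: derived^C)%MS.
  by apply: padded_basis; rewrite mxrank_compl; lia.
pose e k := row (inord k : 'I_3) E.
pose b i j := lie_br n (e i) (e j).
pose P := \matrix_(i < 6) nth 0 [:: e 0; e 1; e 2; b 0 1; b 0 2; b 1 2]%N i.
have PE (x0 x1 x2 x3 x4 x5 : R) : row6 x0 x1 x2 x3 x4 x5 *m P =
    x0 *: e 0%N + x1 *: e 1%N + x2 *: e 2%N
    + (x3 *: b 0%N 1%N + x4 *: b 0%N 2%N + x5 *: b 1%N 2%N).
  by rewrite mulmx_sum_row !big_ord_recl big_ord0 !rowK !mxE /= addr0 !addrA.
have bD i j : (b i j <= derived)%MS by exact: br_sub_derived.
have brPP (x y : 'rV[R]_6) : lie_br n (x *m P) (y *m P) = n32_br x y *m P.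
  elim/row6_ind: x => x0 x1 x2 x3 x4 x5; elim/row6_ind: y => y0 y1 y2 y3 y4 y5.
  rewrite n32_br6 !PE !scale0r !add0r.
  rewrite linearDl [X in _ + X]derived_central ?addr0; last first.
    by rewrite !addmx_sub // scalemx_sub.
  rewrite linearDr [X in _ + X]lie_antisym [X in _ - X]derived_central; last first.
    by rewrite !addmx_sub // scalemx_sub.
  rewrite oppr0 addr0 !(linearDl, linearDr) /= !(linearZl_LR, linearZr_LR) /=.
  rewrite -![lie_br n (e _) (e _)]/(b _ _).
  have bb i : b i i = 0 by exact: lie_alt.
  have bC i j : b i j = - b j i by exact: lie_antisym.
  rewrite !bb !scaler0 (bC 1%N 0%N) (bC 2%N 0%N) (bC 2%N 1%N).
  by apply/rowP => k; rewrite !mxE; ring.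
have Pfull : row_full P.
  have EP : (E <= P)%MS.
    apply/row_subP => k.
    rewrite (_ : row k E = row (inord k) P) ?row_sub // rowK inordK; last first.
      by rewrite (leq_trans (ltn_ord k)).
    rewrite -{1}[k]inord_val -/(e k).
    by case: k => [[|[|[|]]]].
  rewrite -sub1mx; apply: (@submx_trans _ _ _ _ _ _ (derived + derived^C)%MS).
    by rewrite submx_full // addsmx_compl_full.
  rewrite addsmx_sub -eE EP andbT; apply: derived_sub => x y.
  have [|w [w' ->]] := br_complement (E := E) _ x y; first by rewrite eE.
  have /submxP[v ->] := submx_trans (submxMl w E) EP.
  have /submxP[v' ->] := submx_trans (submxMl w' E) EP.
  by rewrite brPP submxMl.
apply: (lie_iso_of_basis (P := P) (m := free_two_step_3 R)) => //.
by rewrite /row_free (eqP (Pfull : _ == _)) pE.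
Qed.

End Derived.

(** * Sums of two Heisenberg algebras *)

Section HeisenbergVectors.
Variable R : realType.

Definition heis1 (a b c : R) : 'rV[R]_(1 + 1 + 1) :=
  row_mx (row_mx a%:M b%:M) c%:M.

Lemma heis1_ind (P : 'rV[R]_(1 + 1 + 1) -> Prop) :
  (forall a b c, P (heis1 a b c)) -> forall x, P x.
Proof.
move=> H x; rewrite -[x]hsubmxK -[lsubmx x]hsubmxK.
rewrite [lsubmx (lsubmx x)]mx11_scalar [rsubmx (lsubmx x)]mx11_scalar.
by rewrite [rsubmx x]mx11_scalar; exact: H.
Qed.

Lemma heis1_br a b c a' b' c' :
  lie_br (heisenberg R 1) (heis1 a b c) (heis1 a' b' c') = heis1 0 0 (a * b' - a' * b).
Proof.
have z : 0%:M = 0 :> 'M[R]_1 by exact: raddf0.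
by rewrite /= heisenberg_br_row !tr_scalar_mx -!scalar_mxM /heis1 z row_mx0 raddfB.
Qed.

Lemma heis1_mul p (u v w : 'rV[R]_p) a b c :
  heis1 a b c *m col_mx (col_mx u v) w = a *: u + b *: v + c *: w.
Proof. by rewrite /heis1 !mul_row_col !mul_scalar_mx. Qed.

End HeisenbergVectors.

Section HeisenbergSquared.
Variables (R : realType) (n : lie_algebra R).
Hypothesis n2 : two_step_nilpotent n.
Implicit Types x y : 'rV[R]_(lie_dim n).

Lemma derived_not_line_free (w1 w2 : 'rV[R]_(lie_dim n)) s t :
  ~ derived_line n ->
  (forall x y, exists a b, lie_br n x y = a *: w1 + b *: w2) ->
  s *: w1 + t *: w2 = 0 -> s = 0 /\ t = 0.
Proof.
move=> nline brw st0; split.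
  have [//|s0] := eqVneq s 0; case: nline; exists w2 => x y.
  have [a [b ->]] := brw x y; exists (b - a * (s^-1 * t)).
  have -> : w1 = - (s^-1 * t) *: w2.
    apply: (scalerI s0); rewrite scalerA mulrN mulrA divff // mul1r scaleNr.
    by apply/eqP; rewrite -addr_eq0 st0.
  by rewrite scalerA mulrN -scalerDl addrC.
have [//|t0] := eqVneq t 0; case: nline; exists w1 => x y.
have [a [b ->]] := brw x y; exists (a - b * (t^-1 * s)).
have -> : w2 = - (t^-1 * s) *: w1.
  apply: (scalerI t0); rewrite scalerA mulrN mulrA divff // mul1r scaleNr.
  by apply/eqP; rewrite -addr_eq0 addrC st0.
by rewrite scalerA mulrN -scalerDl.
Qed.

(** The brackets of the two planes are independent because the derived algebra is
    not a line. Bracketing a linear relation among the generators and these two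
    vectors with the generators then shows that it is trivial. *)
Lemma lie_iso_heisenberg_squared (u1 u2 k1 k2 : 'rV[R]_(lie_dim n)) :
  ~ derived_line n ->
  lie_br n u1 k1 = 0 -> lie_br n u1 k2 = 0 ->
  lie_br n u2 k1 = 0 -> lie_br n u2 k2 = 0 ->
  (forall x, exists a b c d,
     (x - (a *: u1 + b *: u2 + (c *: k1 + d *: k2)) <= derived n)%MS) ->
  lie_iso n (lie_dsum (heisenberg R 1) (heisenberg R 1)).
Proof.
move=> nline uk11 uk12 uk21 uk22 span.
pose w1 := lie_br n u1 u2; pose w2 := lie_br n k1 k2.
have n2l x y z : lie_br n (lie_br n x y) z = 0 by exact: (proj2 n2).
have brE a b c d a' b' c' d' :
    lie_br n (a *: u1 + b *: u2 + (c *: k1 + d *: k2))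
      (a' *: u1 + b' *: u2 + (c' *: k1 + d' *: k2))
    = (a * b' - b * a') *: w1 + (c * d' - d * c') *: w2.
  rewrite !(linearDl, linearDr) /= !(linearZl_LR, linearZr_LR) /= !lie_alt.
  rewrite !(lie_antisym k1 u1, lie_antisym k2 u1, lie_antisym k1 u2,
    lie_antisym k2 u2) uk11 uk12 uk21 uk22 (lie_antisym u2) (lie_antisym k2).
  by rewrite -/w1 -/w2; apply/rowP => i; rewrite !mxE; ring.
have brw x y : exists s t, lie_br n x y = s *: w1 + t *: w2.
  have [a [b [c [d Hx]]]] := span x; have [a' [b' [c' [d' Hy]]]] := span y.
  exists (a * b' - b * a'), (c * d' - d * c'); rewrite -brE.
  rewrite -{1}[x](subrK (a *: u1 + b *: u2 + (c *: k1 + d *: k2))).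
  rewrite linearDl derived_central // add0r lie_antisym [RHS]lie_antisym; congr (- _).
  rewrite -{1}[y](subrK (a' *: u1 + b' *: u2 + (c' *: k1 + d' *: k2))).
  by rewrite linearDl derived_central // add0r.
have wfree s t : s *: w1 + t *: w2 = 0 -> s = 0 /\ t = 0.
  exact: derived_not_line_free.
have wcen s t y : lie_br n (s *: w1 + t *: w2) y = 0.
  by rewrite linearDl !linearZl_LR !n2l !scaler0 addr0.
pose P := col_mx (col_mx (col_mx u1 u2) w1) (col_mx (col_mx k1 k2) w2).
have PE a b s c d t : row_mx (heis1 a b s) (heis1 c d t) *m P
    = a *: u1 + b *: u2 + (c *: k1 + d *: k2) + (s *: w1 + t *: w2).
  by rewrite /P mul_row_col !heis1_mul addrACA.
have brPP (x y : 'rV[R]_((1 + 1 + 1) + (1 + 1 + 1))) : lie_br n (x *m P) (y *m P)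
    = lie_br (lie_dsum (heisenberg R 1) (heisenberg R 1)) x y *m P.
  rewrite -[x]hsubmxK -[y]hsubmxK; move: (lsubmx x) (rsubmx x) (lsubmx y) (rsubmx y).
  elim/heis1_ind=> a b s; elim/heis1_ind=> c d t.
  elim/heis1_ind=> a' b' s'; elim/heis1_ind=> c' d' t'.
  rewrite /= /dsum_br !row_mxKl !row_mxKr. rewrite !heis1_br !PE !scale0r !add0r.
  rewrite linearDl wcen addr0 lie_antisym linearDl wcen addr0 -lie_antisym brE.
  by rewrite (mulrC b) (mulrC d).
have Pfree : row_free P.
  apply: inj_row_free => x.
  rewrite -[x]hsubmxK; move: (lsubmx x) (rsubmx x).
  elim/heis1_ind=> a b s; elim/heis1_ind=> c d t xP0.
  have eq0 a' b' c' d' : a * b' - a' * b = 0 /\ c * d' - c' * d = 0.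
    apply: wfree; have := brPP (row_mx (heis1 a b s) (heis1 c d t))
      (row_mx (heis1 a' b' 0) (heis1 c' d' 0)).
    rewrite xP0 linear0l /= /dsum_br !row_mxKl !row_mxKr !heis1_br PE.
    by rewrite !scale0r !add0r => <-.
  have [] := eq0 0 1 0 1; rewrite !mulr1 !mul0r !subr0 => a0 c0.
  have [] := eq0 1 0 1 0; rewrite !mulr0 !mul1r !sub0r => /eqP + /eqP.
  rewrite !oppr_eq0 => /eqP b0 /eqP d0; move: xP0.
  rewrite PE a0 b0 c0 d0 !scale0r !add0r => /wfree[s0 t0].
  by rewrite s0 t0 /heis1 (raddf0 (@scalar_mx R 1)) !row_mx0.
have Pfull : row_full P.
  have := submx_refl P; rewrite {1}/P !col_mx_sub.
  case/andP=> /andP[/andP[u1P u2P] w1P] /andP[/andP[k1P k2P] w2P].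
  rewrite -sub1mx; apply/row_subP => i; set x := row i _.
  have [a [b [c [d Hx]]]] := span x.
  rewrite -[x](subrK (a *: u1 + b *: u2 + (c *: k1 + d *: k2))).
  apply: addmx_sub; last by rewrite !addmx_sub // scalemx_sub.
  apply: submx_trans Hx _; apply: derived_sub => y z.
  by have [s [t ->]] := brw y z; rewrite addmx_sub // scalemx_sub.
apply: (lie_iso_of_basis (P := P) (m := lie_dsum (heisenberg R 1) (heisenberg R 1))) => //.
Qed.

End HeisenbergSquared.

(** * Real matrices and orthonormal bases *)

Section RealMatrices.
Variable R : realType.

Lemma mulmx_tr_eq0 m q (X : 'M[R]_(m, q)) : X *m X^T = 0 -> X = 0.
Proof.
move=> X0; apply/row_matrixP => i; rewrite row0; apply/eqP.
apply: contraT => /row_dot_gt0; rewrite (_ : row_dot _ _ = (X *m X^T) i i).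
  by rewrite X0 mxE ltxx.
by rewrite mxE; apply: eq_bigr => k _; rewrite !mxE.
Qed.

Lemma form_inj m q (M N : 'M[R]_(m, q)) :
  (forall (x : 'rV_m) (y : 'rV_q), (x *m M *m y^T) 0 0 = (x *m N *m y^T) 0 0) -> M = N.
Proof.
move=> MN; apply/matrixP => i j.
have := MN (delta_mx 0 i) (delta_mx 0 j).
by rewrite -!rowE trmx_delta -!colE [col j _ _ _]mxE [RHS]mxE [row i M _ _]mxE [RHS]mxE.
Qed.

(** A complex eigenvector x + i y with eigenvalue a + i b of a symmetric real
    matrix satisfies b (|x|^2 + |y|^2) = 0. *)
Lemma symmetric_eigenvector q (M : 'M[R]_q) : (0 < q)%N -> M^T = M ->
  exists a (v : 'rV_q), v != 0 /\ v *m M = a *: v.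
Proof.
move=> q0 symM; pose MC := map_mx (real_complex R) M.
have /closed_rootP[l] : size (char_poly MC) != 1%N.
  by rewrite size_char_poly eqSS -lt0n.
rewrite -eigenvalue_root_char => /eigenvalueP[v vM v0].
pose x := map_mx (@complex.Re R) v; pose y := map_mx (@complex.Im R) v.
pose a := complex.Re l; pose b := complex.Im l.
have ReD : {morph @complex.Re R : u w / u + w} by case=> [u u'] [w w'].
have ImD : {morph @complex.Im R : u w / u + w} by case=> [u u'] [w w'].
have xM : x *m M = a *: x - b *: y.
  apply/rowP => j; have /rowP/(_ j)/(congr1 (@complex.Re R)) := vM.
  rewrite !mxE (big_morph _ ReD (erefl _)) => E.
  transitivity (complex.Re (l * v 0 j)).
    rewrite -E; apply: eq_bigr => k _; rewrite !mxE.
    by case: (v 0 k) => c d /=; rewrite mulr0 subr0.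
  by rewrite /a /b; case: (l) (v 0 j) => [c d] [c' d'].
have yM : y *m M = b *: x + a *: y.
  apply/rowP => j; have /rowP/(_ j)/(congr1 (@complex.Im R)) := vM.
  rewrite !mxE (big_morph _ ImD (erefl _)) => E.
  transitivity (complex.Im (l * v 0 j)).
    rewrite -E; apply: eq_bigr => k _; rewrite !mxE.
    by case: (v 0 k) => c d /=; rewrite mulr0 add0r.
  by rewrite /a /b; case: (l) (v 0 j) => [c d] [c' d'] /=; rewrite addrC.
pose d (u w : 'rV[R]_q) := row_dot u w.
have dM u w : d (u *m M) w = d u (w *m M).
  have dE (r s : 'rV[R]_q) : d r s = (r *m s^T) 0 0.
    by rewrite mxE; apply: eq_bigr => k _; rewrite mxE.
  by rewrite !dE trmx_mul symM mulmxA.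
have b0 : b * (d x x + d y y) = 0.
  pose D := std_dot R q.
  have := dM x y; rewrite xM yM => E.
  have : D (a *: x - b *: y) y = D x (b *: x + a *: y) by exact: E.
  rewrite dotBl dotDr !dotZl !dotZr => E'.
  by rewrite -[d x x]/(D x x) -[d y y]/(D y y); lra.
have xy0 : (x != 0) || (y != 0).
  rewrite -negb_and; apply: contra v0 => /andP[/eqP x0 /eqP y0].
  apply/eqP/rowP => j; move/rowP/(_ j): x0; move/rowP/(_ j): y0; rewrite !mxE.
  by case: (v 0 j) => c c' /= -> ->.
have d_ge0 (u : 'rV[R]_q) : 0 <= d u u.
  by apply: sumr_ge0 => i _; rewrite -expr2 sqr_ge0.
have {}b0 : b = 0.
  move/eqP: b0; rewrite mulf_eq0 => /orP[/eqP //|]; rewrite paddr_eq0 //.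
  case/orP: xy0 => /row_dot_gt0; rewrite lt0r => /andP[/negbTE + _].
    by rewrite -/(d x x) => ->.
  by rewrite -/(d y y) => ->; rewrite andbF.
move: xM yM; rewrite b0 !scale0r subr0 add0r => xM yM.
by case/orP: xy0 => nz; exists a; first [by exists x | by exists y].
Qed.

(** The form of A on its own row space is skew and nondegenerate. *)
Lemma skew_rank_even q (A : 'M[R]_q) : A^T = - A -> ~~ odd (\rank A).
Proof.
move=> skewA; have eqB := eq_row_base A; have Bfree := row_base_free A.
move: (row_base A) eqB Bfree => B eqB Bfree; pose M := B *m A *m B^T.
have skewM : M^T = - M by rewrite /M !trmx_mul trmxK skewA mulNmx mulmxN mulmxA.
have : row_free M.
  apply: inj_row_free => x xM0; pose y := x *m B *m A.
  have y0 : y = 0.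
    apply: mulmx_tr_eq0.
    have /submxP[z yz] : (y <= B)%MS by rewrite eqB submxMl.
    have yB : y *m B^T = 0 by rewrite -xM0 /M !mulmxA.
    by rewrite {2}yz trmx_mul mulmxA yB mul0mx.
  have xB0 : x *m B = 0.
    apply: mulmx_tr_eq0.
    have /submxP[w xw] : (x *m B <= A)%MS.
      by rewrite -eqB submxMl.
    by rewrite {2}xw trmx_mul skewA mulNmx mulmxN mulmxA -/y y0 mul0mx oppr0.
  by apply: (row_free_inj Bfree); rewrite xB0 mul0mx.
rewrite row_free_unit unitmxE unitfE => detM; apply: contra detM => odd_r.
have := det_tr M; rewrite skewM -scaleN1r detZ -signr_odd odd_r expr1 => E.
by apply/eqP; lra.
Qed.

Lemma orthogonal_hyperplane p (ip : {dot 'rV[R]_p for idfun}) (e : 'rV[R]_p) :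
  exists K : 'M[R]_p, forall w : 'rV_p, (w <= K)%MS = (ip w e == 0).
Proof.
have f_lin : linear (fun w : 'rV[R]_p => (ip w e)%:M : 'M[R]_1).
  by move=> c v w; rewrite dotDl dotZl raddfD /= -scale_scalar_mx.
exists (kermx (lin1_mx (linear_of f_lin))) => w.
apply/sub_kermxP/eqP; rewrite mul_rV_lin1 /=.
  by move=> /matrixP/(_ 0 0); rewrite !mxE mulr1n.
by move=> ->; exact: raddf0.
Qed.

Lemma orthonormal_basis p (ip : {dot 'rV[R]_p for idfun}) m (U : 'M[R]_(m, p)) :
  exists B : 'M[R]_(\rank U, p),
    (B :=: U)%MS /\ forall i j, ip (row i B) (row j B) = (i == j)%:R.
Proof.
suff H r : forall m (U : 'M[R]_(m, p)), \rank U = r -> exists B : 'M[R]_(r, p),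
    (B :=: U)%MS /\ forall i j, ip (row i B) (row j B) = (i == j)%:R by exact: H.
elim: r => {m U} [|r IH] m U rU.
  exists 0; split=> [|[]//]; apply/eqmxP.
  by move/eqP: rU; rewrite mxrank_eq0 => /eqP ->; rewrite !sub0mx.
pose u := nz_row U.
have u0 : u != 0 by rewrite nz_row_eq0 -mxrank_eq0 rU.
have uU : (u <= U)%MS by exact: nz_row_sub.
have uu := dot_gt0 ip u0.
pose e := (Num.sqrt (ip u u))^-1 *: u.
have ee : ip e e = 1.
  rewrite dotZl dotZr mulrA -invfM -expr2 sqr_sqrtr ?ltW //.
  by rewrite mulVf // lt0r_neq0.
have eU : (e <= U)%MS by exact: scalemx_sub.
clearbody e.
have [K KP] := orthogonal_hyperplane ip e.
pose U' := (U :&: K)%MS.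
have UE : (e + U' :=: U)%MS.
  apply/eqmxP; rewrite addsmx_sub eU capmxSl /=; apply/row_subP => i.
  set w := row i U; have wU : (w <= U)%MS by exact: row_sub.
  rewrite -[w](subrK (ip w e *: e)) addrC; apply: addmx_sub_adds.
    exact: scalemx_sub (submx_refl _).
  rewrite sub_capmx; apply/andP; split.
    by apply: addmx_sub wU _; rewrite eqmx_opp; exact: scalemx_sub eU.
  by rewrite KP dotBl dotZl ee mulr1 subrr.
have rU' : \rank U' = r.
  have e0 : e != 0.
    by apply/eqP => e0; move/eqP: ee; rewrite e0 dot0l eq_sym oner_eq0.
  have eU'0 : (e :&: U')%MS = 0.
    apply/eqP; rewrite -submx0; apply/row_subP => i; rewrite submx0.
    set w := row i _.
    have := row_sub i (e :&: U')%MS; rewrite -/w sub_capmx => /andP[/sub_rVP[c wc]].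
    move=> /submx_trans/(_ (capmxSr _ _)); rewrite KP wc dotZl ee mulr1 => /eqP ->.
    by rewrite scale0r.
  have := mxrank_disjoint_sum eU'0; rewrite UE rU rank_rV e0 add1n => -[].
  by move=> ->.
have [B [BU' Bon]] := IH _ U' rU'.
exists (col_mx e B : 'M[R]_(1 + r, p)); split.
  apply: (eqmx_trans (eqmx_sym (addsmxE e B))).
  exact: eqmx_trans (adds_eqmx (eqmx_refl _) BU') UE.
have Be i : ip (row i B) e = 0.
  apply/eqP; rewrite -KP; apply: submx_trans (row_sub _ _) _.
  by rewrite BU' capmxSr.
suff on (i j : 'I_(1 + r)) :
    ip (row i (col_mx e B)) (row j (col_mx e B)) = (i == j)%:R by exact: on.
rewrite -(fintype.splitK i) -(fintype.splitK j).
case: (fintype.split i) => [i'|i']; case: (fintype.split j) => [j'|j'] /=.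
- by rewrite !rowKu !row_id !ord1 ee eqxx.
- by rewrite rowKu rowKd row_id dotC Be eq_lrshift.
- by rewrite rowKu rowKd row_id Be eq_rlshift.
- by rewrite !rowKd Bon eq_rshift.
Qed.

End RealMatrices.

(** * Algebras whose derived algebra is a plane *)

(** The rows of E span a complement of the derived plane, which contains z1 and
    z2; J1 and J2 are the components of the bracket. *)
Section RankTwo.
Variables (R : realType) (n : lie_algebra R).
Hypothesis n2 : two_step_nilpotent n.
Hypothesis nline : ~ derived_line n.
Local Notation V := 'rV[R]_(lie_dim n).
Variables (q : nat) (E : 'M[R]_(q, lie_dim n)) (z1 z2 : V).
Implicit Types x y w : 'rV[R]_q.
Hypotheses (z1D : (z1 <= derived n)%MS) (z2D : (z2 <= derived n)%MS).
Hypothesis span : forall v : V, exists x s t, v = x *m E + (s *: z1 + t *: z2).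
Hypothesis q4 : (q <= 4)%N.

Variables J1 J2 : 'M[R]_q.
Hypotheses (J1skew : J1^T = - J1) (J2skew : J2^T = - J2).
Hypothesis brE : forall x y, lie_br n (x *m E) (y *m E)
  = (x *m J1 *m y^T) 0 0 *: z1 + (x *m J2 *m y^T) 0 0 *: z2.

Lemma br_z1 v : lie_br n z1 v = 0. Proof. exact: derived_central. Qed.
Lemma br_z2 v : lie_br n z2 v = 0. Proof. exact: derived_central. Qed.

Lemma br_span v v' : exists x y, lie_br n v v' = lie_br n (x *m E) (y *m E).
Proof.
have [x [s [t ->]]] := span v; have [y [s' [t' ->]]] := span v'; exists x, y.
have cen r r' u : lie_br n (r *: z1 + r' *: z2) u = 0.
  by rewrite linearDl !linearZl_LR br_z1 br_z2 !scaler0 addr0.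
rewrite linearDl cen addr0 lie_antisym linearDl cen addr0.
by rewrite -lie_antisym.
Qed.

Lemma pencil_neq0 c : J2 - c *: J1 != 0.
Proof.
apply/eqP => J0; apply: nline; exists (z1 + c *: z2) => v v'.
have [x [y ->]] := br_span v v'; exists ((x *m J1 *m y^T) 0 0).
have J2E : J2 = c *: J1 by apply/eqP; rewrite -subr_eq0 J0.
have e : (x *m J2 *m y^T) 0 0 = c * (x *m J1 *m y^T) 0 0.
  by rewrite J2E -scalemxAr -scalemxAl mxE.
by rewrite brE e scalerDr scalerA (mulrC c).
Qed.

Lemma J1_neq0 : J1 != 0.
Proof.
apply/eqP => J0; apply: nline; exists z2 => v v'.
have [x [y ->]] := br_span v v'; exists ((x *m J2 *m y^T) 0 0).
by rewrite brE J0 mulmx0 mul0mx mxE scale0r add0r.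
Qed.

(** The row space of A and its orthogonal complement are commuting planes. *)
Lemma split_of_singular (A C1 C2 : 'M[R]_q) :
  A^T = - A -> A != 0 -> ~~ row_full A ->
  A *m J1 = C1 *m A -> A *m J2 = C2 *m A ->
  lie_iso n (lie_dsum (heisenberg R 1) (heisenberg R 1)).
Proof.
move=> skewA A0 Asing AJ1 AJ2.
(* The rank is even, positive and less than q, and q is at most 4. *)
have rA : \rank A = 2.
  have := skew_rank_even skewA; have := rank_leq_row A.
  move: A0 Asing; rewrite -mxrank_eq0 /row_full.
  by move: (\rank A) => r; lia.
have [U eU] : exists U : 'M[R]_(2, q), (U :=: A)%MS by apply: padded_basis; rewrite rA.
have [K eK] : exists K : 'M[R]_(2, q), (K :=: kermx A)%MS.
  by apply: padded_basis; rewrite mxrank_ker rA; lia.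
have UK0 (x y : 'rV_q) : (x <= U)%MS -> (y <= K)%MS ->
    lie_br n (x *m E) (y *m E) = 0.
  rewrite eU eK => /submxP[w ->] /sub_kermxP yA.
  have Ay : A *m y^T = 0 by rewrite -[A]opprK -skewA mulNmx -trmx_mul yA trmx0 oppr0.
  by rewrite brE -!(mulmxA w) AJ1 AJ2 -!mulmxA Ay !mulmx0 !mxE !scale0r addr0.
have UKfull : row_full (U + K)%MS.
  have disj : (A :&: kermx A)%MS = 0.
    apply/eqP; rewrite -submx0; apply/row_subP => i; rewrite submx0.
    have := row_sub i (A :&: kermx A)%MS; set x := row i _.
    rewrite sub_capmx => /andP[/submxP[w xw] /sub_kermxP xA].
    apply/eqP; apply: mulmx_tr_eq0.
    by rewrite {2}xw trmx_mul skewA mulNmx mulmxN mulmxA xA mul0mx oppr0.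
  rewrite /row_full (adds_eqmx eU eK) (mxrank_disjoint_sum disj) mxrank_ker.
  by rewrite subnKC // rank_leq_row.
apply: (@lie_iso_heisenberg_squared _ _ n2 (row 0 U *m E) (row 1 U *m E)
  (row 0 K *m E) (row 1 K *m E)) => //; try by apply: UK0; exact: row_sub.
move=> v; have [x [s [t ->]]] := span v.
have /sub_addsmxP[[u k] /= xE] := submx_full x UKfull.
have two (M : 'M[R]_(2, q)) (c : 'rV_2) :
    c *m M = c 0 0 *: row 0 M + c 0 1 *: row 1 M.
  rewrite mulmx_sum_row !big_ord_recl big_ord0 addr0.
  by rewrite (_ : lift ord0 ord0 = 1) //; exact: val_inj.
exists (u 0 0), (u 0 1), (k 0 0), (k 0 1).
have -> : u 0 0 *: (row 0 U *m E) + u 0 1 *: (row 1 U *m E)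
    + (k 0 0 *: (row 0 K *m E) + k 0 1 *: (row 1 K *m E)) = x *m E.
  by rewrite xE !two !mulmxDl -!scalemxAl.
by rewrite addrC addKr addmx_sub // scalemx_sub.
Qed.

(** A symmetric matrix has a real eigenvalue. If c is an eigenvalue of J1^-1 J2,
    then J2 - c J1 is singular. *)
Lemma split_of_commuting : J1 *m J2 = J2 *m J1 ->
  lie_iso n (lie_dsum (heisenberg R 1) (heisenberg R 1)).
Proof.
move=> J12; have [J1unit|J1sing] := boolP (row_full J1); last first.
  exact: (split_of_singular (C1 := J1) (C2 := J2) J1skew J1_neq0).
have J1u : J1 \in unitmx by rewrite -row_full_unit.
pose M := invmx J1 *m J2.
have symM : M^T = M.
  apply: (can_inj (mulmxK J1u)).
  have -> : M *m J1 = J2 by rewrite /M -mulmxA -J12 mulKmx.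
  by rewrite -[J1 in LHS]opprK -J1skew mulmxN -trmx_mul mulKVmx // J2skew opprK.
have q0 : (0 < q)%N.
  rewrite lt0n; apply/negP => /eqP q0; move/negP: J1_neq0; apply; apply/eqP.
  by apply/matrixP => i; exfalso; move: (ltn_ord i); rewrite {2}q0.
have [c [v [v0 vM]]] := symmetric_eigenvector q0 symM.
apply: (split_of_singular (A := J2 - c *: J1) (C1 := J1) (C2 := J2)).
- by rewrite linearB linearZ /= J1skew J2skew scalerN opprB opprK addrC.
- exact: pencil_neq0.
- apply/negP => full; case/negP: v0.
  have: v *m invmx J1 *m (J2 - c *: J1) = 0.
    by rewrite mulmxBr -scalemxAr -!mulmxA -/M vM mulVmx // mulmx1 subrr.
  move=> /eqP; rewrite mulmx_free_eq0; last by rewrite row_free_unit -row_full_unit.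
  by rewrite mulmx_free_eq0 // row_free_unit unitmx_inv.
- by rewrite mulmxBl mulmxBr -scalemxAl -scalemxAr J12.
- by rewrite mulmxBl mulmxBr -scalemxAl -scalemxAr J12.
Qed.

(** The components of an alternating 3-form and the relations imposed on them by
    the Killing equation: S1 and S2 take one argument z1 or z2, xi takes both, and b
    takes none. *)
Variables (S1 S2 : 'M[R]_q) (xi : 'rV[R]_q) (b : 'rV[R]_q -> 'rV[R]_q -> 'rV[R]_q -> R).
Hypotheses (S1skew : S1^T = - S1) (S2skew : S2^T = - S2) (altb : alternating3 b).
Hypothesis JS11 : J1 *m S1 = S1 *m J1.
Hypothesis JS22 : J2 *m S2 = S2 *m J2.
Hypothesis JS12 : 2 *: (J1 *m S2) = S2 *m J1 + J2 *m S1.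
Hypothesis JS21 : 2 *: (J2 *m S1) = S1 *m J2 + J1 *m S2.
Hypotheses (xiJ1 : xi *m J1 = 0) (xiJ2 : xi *m J2 = 0).
Hypothesis bJ1 : forall x y,
  b x y (x *m J1) = - ((x *m J2 *m y^T) 0 0 * row_dot x xi).
Hypothesis bJ1_kill : S1 = 0 -> S2 = 0 -> xi = 0 -> forall x y w,
  b (x *m J1) y w + 2^-1 * b x (y *m J1) w + 2^-1 * b x y (w *m J1) = 0.

(** Transposing the mixed relations yields a linear system that forces all four
    mixed products to coincide. *)
Lemma mixed_products :
  [/\ S1 *m J2 = J2 *m S1, S2 *m J1 = J1 *m S2 & S1 *m J2 = S2 *m J1].
Proof.
have tr (M N : 'M[R]_q) : M^T = - M -> N^T = - N -> (M *m N)^T = N *m M.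
  by move=> Ms Ns; rewrite trmx_mul Ms Ns mulmxN mulNmx opprK.
have H1 := congr1 trmx JS12; have H2 := congr1 trmx JS21.
rewrite linearZ linearD /= !tr // in H1; rewrite linearZ linearD /= !tr // in H2.
move: JS12 JS21 H1 H2.
move: (J1 *m S2) (S2 *m J1) (J2 *m S1) (S1 *m J2) => X X' Y Y' /matrixP E1 /matrixP E2.
move=> /matrixP E3 /matrixP E4; split; apply/matrixP => i j;
by move: (E1 i j) (E2 i j) (E3 i j) (E4 i j); rewrite !mxE; lra.
Qed.

(** If S1 is invertible, then J1 and J2 commute, since
    S1 J1 J2 = J1 S2 J1 = S2 J1 J1 = S1 J2 J1. *)
Lemma split_of_S1 : S1 != 0 ->
  lie_iso n (lie_dsum (heisenberg R 1) (heisenberg R 1)).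
Proof.
have [m1 m2 m3] := mixed_products.
move=> S1n0; have [S1unit|S1sing] := boolP (row_full S1); last first.
  exact: (split_of_singular (C1 := J1) (C2 := J2) S1skew S1n0 S1sing).
have {}S1unit : S1 \in unitmx by rewrite -row_full_unit.
apply: split_of_commuting; apply: (can_inj (mulKmx S1unit)).
have -> : S1 *m (J2 *m J1) = S2 *m J1 *m J1 by rewrite mulmxA m3.
have -> : S1 *m (J1 *m J2) = J1 *m (S1 *m J2) by rewrite mulmxA -JS11 mulmxA.
by rewrite m3 mulmxA -m2.
Qed.

(** An invertible S2 would give S2 J1 = S1 J2 = 0, hence J1 = 0. *)
Lemma split_of_S2 : S1 = 0 -> S2 != 0 ->
  lie_iso n (lie_dsum (heisenberg R 1) (heisenberg R 1)).
Proof.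
have [m1 m2 m3] := mixed_products.
move=> S10 S2n0; have [S2unit|S2sing] := boolP (row_full S2); last first.
  exact: (split_of_singular (C1 := J1) (C2 := J2) S2skew S2n0 S2sing).
have {}S2unit : S2 \in unitmx by rewrite -row_full_unit.
case/negP: J1_neq0; apply/eqP; apply: (can_inj (mulKmx S2unit)).
by rewrite -m3 S10 mul0mx mulmx0.
Qed.

(** Polarized at xi, the equation for b shows that J2 is a multiple of T J1,
    where T is the matrix of b xi. Hence the row space of J1 is stable under J2; it is
    not everything because xi J1 = 0. *)
Lemma split_of_xi : xi != 0 ->
  lie_iso n (lie_dsum (heisenberg R 1) (heisenberg R 1)).
Proof.
move=> xi0; pose c := row_dot xi xi; have c0 : c != 0 by rewrite lt0r_neq0 // row_dot_gt0.
pose T := gram_mx (b xi).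
have TE y w : (y *m T *m w^T) 0 0 = b xi y w.
  exact: (gram_mxE (bilinear_map_of (alt3_bilinear altb xi))).
have TJ1 : T *m J1 = - c *: J2.
  have bxi x y : b xi y (x *m J1) = - (x *m J2 *m y^T) 0 0 * c.
    have := bJ1 (x + xi) y; rewrite !mulmxDl xiJ1 xiJ2 mul0mx !addr0.
    rewrite (alt3D1 altb) bJ1 -[row_dot (x + xi) xi]/(std_dot R q (x + xi) xi) dotDl.
    rewrite -[std_dot R q x xi]/(row_dot x xi) -[std_dot R q xi xi]/c mulrDr; lra.
  have TJ1T : T *m J1^T = - c *: J2^T.
    apply: form_inj => y x; rewrite -!mulmxA -trmx_mul !mulmxA TE bxi.
    rewrite -scalemxAr -scalemxAl [RHS]mxE mulrC mulrN mulNr; congr (- (_ * _)).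
    have -> : y *m J2^T *m x^T = (x *m J2 *m y^T)^T by rewrite !trmx_mul trmxK mulmxA.
    by rewrite [RHS]mxE.
  by move: TJ1T; rewrite J1skew J2skew mulmxN scalerN => /oppr_inj.
apply: (split_of_singular (C1 := J1) (C2 := - c^-1 *: (J1 *m T)) J1skew J1_neq0) => //.
- apply/negP => full; case/negP: xi0; have /eqP := xiJ1.
  by rewrite mulmx_free_eq0 // row_free_unit -row_full_unit.
- by rewrite -scalemxAl -mulmxA TJ1 -scalemxAr scalerA mulrNN mulVf ?scale1r.
Qed.

(** Every term of the last relation equals a multiple of b (x J1) y w, so b
    vanishes on the row space of J1. This has rank at least two, and the quotient of
    dimension at most two has no alternating 3-form. *)
Lemma horizontal_form_eq0 : S1 = 0 -> S2 = 0 -> xi = 0 -> forall x y w, b x y w = 0.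
Proof.
move=> S10 S20 xi0.
have b0 x y : b x y (x *m J1) = 0.
  rewrite bJ1 xi0 (_ : row_dot x 0 = 0) ?mulr0 ?oppr0 //.
  exact: (dot0r (std_dot R q)).
have bpol x x' y : b x y (x' *m J1) = - b x' y (x *m J1).
  have := b0 (x + x') y; rewrite mulmxDl !(alt3D1 altb, alt3D3 altb) !b0; lra.
have bim x y w : b (x *m J1) y w = 0.
  have := bJ1_kill S10 S20 xi0 x y w.
  have -> : b x y (w *m J1) = b (x *m J1) y w by rewrite bpol (alt3_swap13 altb) opprK.
  have -> : b x (y *m J1) w = b (x *m J1) y w.
    by rewrite (alt3_swap23 altb) bpol opprK [RHS](alt3_rot altb).
  lra.
have [C eC] : exists C : 'M[R]_(2, q), (C :=: J1^C)%MS.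
  apply: padded_basis; rewrite mxrank_compl.
  have := skew_rank_even J1skew; have := J1_neq0; rewrite -mxrank_eq0.
  by move: (\rank J1) => r; lia.
have red x : exists s t, forall y w,
    b x y w = b (s *: row 0 C + t *: row 1 C) y w.
  have : (x <= J1 + J1^C)%MS by rewrite submx_full // addsmx_compl_full.
  case/sub_addsmxP=> -[u v] /= ->.
  have /submxP[c ->] : (v *m (J1^C)%MS <= C)%MS by rewrite eC submxMl.
  exists (c 0 0), (c 0 1) => y w; rewrite (alt3D1 altb) bim add0r.
  rewrite mulmx_sum_row !big_ord_recl big_ord0 addr0.
  by rewrite (_ : lift ord0 ord0 = 1) //; exact: val_inj.
move=> x y w; have [s [t ->]] := red x; rewrite (alt3_rot altb).
have [s' [t' ->]] := red y; rewrite (alt3_rot altb); have [s'' [t'' ->]] := red w.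
rewrite !(alt3D1 altb, alt3D2 altb, alt3D3 altb, alt3Z1 altb, alt3Z2 altb,
  alt3Z3 altb, alt3_eq12 altb, alt3_eq13 altb, alt3_eq23 altb).
by rewrite !mulr0 !addr0.
Qed.

End RankTwo.

Section KillingPolarization.
Variables (R : realType) (n : lie_algebra R).
Local Notation V := 'rV[R]_(lie_dim n).
Variables (ip : {dot V for idfun}) (nab : {bilinear V -> V -> V}) (a : V -> V -> V -> R).
Hypotheses (nabLC : levi_civita_product ip nab) (nabK : killing3 nab a).
Implicit Types u v w y z : V.

Lemma koszul u v w : ip (nab u v) w
  = 2^-1 * (ip (lie_br n u v) w - ip v (lie_br n u w) - ip u (lie_br n v w)).
Proof.
have T x y z : ip (lie_br n x y) z = ip (nab x y) z - ip (nab y x) z.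
  by rewrite -(proj1 nabLC) dotBl.
rewrite (dotC ip v) (dotC ip u) !T.
have S x y z : ip (nab x y) z = - ip (nab x z) y.
  by apply/eqP; rewrite -addr_eq0 (dotC _ (nab x z)) (proj2 nabLC).
have := S u v w; have := S v u w; have := S w u v; lra.
Qed.

(** The Killing equation is quadratic in its first argument. *)
Lemma killing3_polar y y' u w :
  a (nab y y') u w + a (nab y' y) u w + a y (nab y' u) w + a y' (nab y u) w
  + a y u (nab y' w) + a y' u (nab y w) = 0.
Proof.
have altA := proj1 nabK.
have := proj2 nabK (y + y') u w; have := proj2 nabK y u w; have := proj2 nabK y' u w.
rewrite !linearDl !linearDr /= !(alt3D1 altA, alt3D2 altA, alt3D3 altA); lra.
Qed.

Lemma dot_inj u v : (forall w, ip u w = ip v w) -> u = v.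
Proof.
move=> uv; apply/eqP; rewrite -subr_eq0; apply/eqP; apply: (dot_eq0 (ip := ip)).
by rewrite dotBl uv subrr.
Qed.

End KillingPolarization.

Lemma dot_orthonormal (R : realType) p q (ip : {dot 'rV[R]_p for idfun})
    (E : 'M[R]_(q, p)) (x y : 'rV[R]_q) :
  (forall i j, ip (row i E) (row j E) = (i == j)%:R) ->
  ip (x *m E) (y *m E) = row_dot x y.
Proof.
move=> Eon; rewrite !mulmx_sum_row dot_suml; apply: eq_bigr => i _.
rewrite dot_sumr (bigD1 i) //= big1 => [|j ji].
  by rewrite dotZl dotZr Eon eqxx mulr1 addr0.
by rewrite dotZl dotZr Eon eq_sym (negbTE ji) !mulr0.
Qed.

Lemma adapted_basis (R : realType) (n : lie_algebra R)
    (ip : {dot 'rV[R]_(lie_dim n) for idfun}) : \rank (derived n) = 2 ->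
  exists q (E : 'M[R]_(q, lie_dim n)) (z1 z2 : 'rV[R]_(lie_dim n)),
  [/\ (q + 2 <= lie_dim n)%N,
      forall x y, ip (x *m E) (y *m E) = row_dot x y,
      [/\ (z1 <= derived n)%MS, (z2 <= derived n)%MS
        & forall v, (v <= derived n)%MS -> v = ip v z1 *: z1 + ip v z2 *: z2],
      forall x, ip (x *m E) z1 = 0 /\ ip (x *m E) z2 = 0
    & forall v, exists x, v = x *m E + (ip v z1 *: z1 + ip v z2 *: z2)].
Proof.
move=> D2.
have [Z [ZD Zon]] : exists Z : 'M[R]_(2, lie_dim n), (Z :=: derived n)%MS /\
    forall i j, ip (row i Z) (row j Z) = (i == j)%:R.
  by have := orthonormal_basis ip (derived n); rewrite D2.
pose z1 := row 0 Z; pose z2 := row 1 Z.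
have z11 : ip z1 z1 = 1 by rewrite Zon.
have z22 : ip z2 z2 = 1 by rewrite Zon.
have z12 : ip z1 z2 = 0 by rewrite Zon.
have zD1 : (z1 <= derived n)%MS by rewrite -ZD row_sub.
have zD2 : (z2 <= derived n)%MS by rewrite -ZD row_sub.
have Dz v : (v <= derived n)%MS -> v = ip v z1 *: z1 + ip v z2 *: z2.
  rewrite -ZD => /submxP[c ->]; rewrite mulmx_sum_row !big_ord_recl big_ord0 addr0.
  rewrite (_ : lift ord0 ord0 = 1); last exact: val_inj.
  rewrite -/z1 -/z2 !dotDl !dotZl z11 z22 z12 (dotC ip z2) z12.
  by rewrite !mulr0 !mulr1 addr0 add0r.
have [K1 K1P] := orthogonal_hyperplane ip z1.
have [K2 K2P] := orthogonal_hyperplane ip z2.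
pose W := (K1 :&: K2)%MS.
have WP (v : 'rV_(lie_dim n)) : (v <= W)%MS = (ip v z1 == 0) && (ip v z2 == 0).
  by rewrite sub_capmx K1P K2P.
have [E [EW Eon]] := orthonormal_basis ip W.
exists (\rank W), E, z1, z2; split=> //.
- have disj : (W :&: derived n)%MS = 0.
    apply/eqP; rewrite -submx0; apply/row_subP => i; rewrite submx0.
    have := row_sub i (W :&: derived n)%MS; set x := row i _.
    rewrite sub_capmx WP => /andP[/andP[/eqP x1 /eqP x2] /Dz ->].
    by rewrite x1 x2 !scale0r addr0.
  have := rank_leq_col (W + derived n)%MS.
  by rewrite (mxrank_disjoint_sum disj) D2.
- by move=> x y; exact: dot_orthonormal.
- move=> x; have : (x *m E <= W)%MS by rewrite -EW submxMl.
  by rewrite WP => /andP[/eqP -> /eqP ->].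
- move=> v; set d := _ + _.
  have /submxP[x xE] : (v - d <= E)%MS.
    rewrite EW WP !dotBl !dotDl !dotZl z11 z22 z12 (dotC ip z2) z12.
    by rewrite !mulr0 !mulr1 addr0 add0r !subrr eqxx.
  by exists x; rewrite -xE subrK.
Qed.

(** In an orthonormal basis adapted to the derived plane the connection is
    nab x y = [x, y] / 2, nab x z = nab z x = - J_z x / 2 and nab z z' = 0 for x, y
    in the complement and z, z' in the plane. The lemmas below are the components of
    the Killing equation. *)
Section KillingRankTwo.
Variables (R : realType) (n : lie_algebra R).
Local Notation V := 'rV[R]_(lie_dim n).
Variables (ip : {dot V for idfun}) (nab : {bilinear V -> V -> V}) (a : V -> V -> V -> R).
Hypotheses (n2 : two_step_nilpotent n).
Hypotheses (nabLC : levi_civita_product ip nab) (nabK : killing3 nab a).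
Variables (q : nat) (E : 'M[R]_(q, lie_dim n)) (z1 z2 : V).
Hypothesis EE : forall x y, ip (x *m E) (y *m E) = row_dot x y.
Hypotheses (z1D : (z1 <= derived n)%MS) (z2D : (z2 <= derived n)%MS).
Hypothesis derivedE : forall v : V, (v <= derived n)%MS ->
  v = ip v z1 *: z1 + ip v z2 *: z2.
Hypothesis Ez : forall x, ip (x *m E) z1 = 0 /\ ip (x *m E) z2 = 0.
Hypothesis span : forall v : V, exists x, v = x *m E + (ip v z1 *: z1 + ip v z2 *: z2).
Implicit Types (x y w : 'rV[R]_q) (u v z : V).

Let altA : alternating3 a := proj1 nabK.

Definition br_form z x y : R := ip (lie_br n (x *m E) (y *m E)) z.

Lemma br_form_bilinear z : bilinear_for *:%R *:%R (br_form z).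
Proof.
split=> w c x y; rewrite /br_form mulmxDl -scalemxAl.
  by rewrite (linearPl (lie_br n)) dotDl dotZl.
by rewrite (linearPr (lie_br n)) dotDl dotZl.
Qed.

Definition killing_pairing z x y : R := a (x *m E) (y *m E) z.

Lemma killing_pairing_bilinear z : bilinear_for *:%R *:%R (killing_pairing z).
Proof.
by split=> w c x y; rewrite /killing_pairing mulmxDl -scalemxAl
  ?(alt3P1 altA) ?(alt3P2 altA).
Qed.

Local Notation J z := (gram_mx (br_form z)).
Local Notation S z := (gram_mx (killing_pairing z)).

Lemma brJ z x y : (x *m J z *m y^T) 0 0 = ip (lie_br n (x *m E) (y *m E)) z.
Proof. exact: (gram_mxE (bilinear_map_of (br_form_bilinear z))). Qed.

Lemma killingS z x y : (x *m S z *m y^T) 0 0 = a (x *m E) (y *m E) z.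
Proof. exact: (gram_mxE (bilinear_map_of (killing_pairing_bilinear z))). Qed.

Lemma J_skew z : (J z)^T = - J z.
Proof.
by apply/matrixP => i j; rewrite !mxE /br_form lie_antisym dotNl.
Qed.

Lemma S_skew z : (S z)^T = - S z.
Proof.
by apply/matrixP => i j; rewrite !mxE /killing_pairing (alt3_swap12 altA).
Qed.

Lemma br_rank_two x y : lie_br n (x *m E) (y *m E)
  = (x *m J z1 *m y^T) 0 0 *: z1 + (x *m J z2 *m y^T) 0 0 *: z2.
Proof. by rewrite !brJ; apply: derivedE; exact: br_sub_derived. Qed.

Lemma derived_centralr u v : (u <= derived n)%MS -> lie_br n v u = 0.
Proof. by move=> uD; rewrite lie_antisym derived_central // oppr0. Qed.

Lemma nab_EE x y : nab (x *m E) (y *m E) = 2^-1 *: lie_br n (x *m E) (y *m E).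
Proof.
have perp x' u v : ip (x' *m E) (lie_br n u v) = 0.
  rewrite [lie_br n u v]derivedE ?br_sub_derived // dotDr !dotZr (Ez x').1 (Ez x').2.
  by rewrite !mulr0 addr0.
apply: (dot_inj (ip := ip)) => v; rewrite (koszul nabLC) dotZl !perp.
by rewrite !subr0.
Qed.

Lemma nab_Ez z x : (z <= derived n)%MS ->
  nab (x *m E) z = - 2^-1 *: (x *m J z *m E).
Proof.
move=> zD; apply: (dot_inj (ip := ip)) => v; rewrite (koszul nabLC).
rewrite (derived_centralr _ zD) (derived_central n2 _ zD) dot0l dot0r subr0 sub0r.
have [w] := span v; set d := (X in _ + X) => vE.
have dD : (d <= derived n)%MS by apply: addmx_sub; exact: scalemx_sub.
rewrite {}vE linearDr (derived_centralr _ dD) addr0 dotZl dotDr EE.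
have -> : ip (x *m J z *m E) d = 0 by rewrite dotDr !dotZr (Ez (x *m J z)).1
  (Ez (x *m J z)).2 !mulr0 addr0.
rewrite addr0 mulrN mulNr dotC -brJ; congr (- (_ * _)).
by rewrite mxE; apply: eq_bigr => k _; rewrite [w^T _ _]mxE.
Qed.

Lemma nab_zE z x : (z <= derived n)%MS ->
  nab z (x *m E) = - 2^-1 *: (x *m J z *m E).
Proof.
move=> zD; rewrite -nab_Ez //; apply/eqP; rewrite eq_sym -subr_eq0.
by rewrite (proj1 nabLC) derived_centralr.
Qed.

Lemma nab_zz z z' : (z <= derived n)%MS -> (z' <= derived n)%MS -> nab z z' = 0.
Proof.
move=> zD z'D; apply: (dot_inj (ip := ip)) => v; rewrite (koszul nabLC).
rewrite !(derived_central n2 _ zD) !(derived_central n2 _ z'D) dot0l !dot0r.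
by rewrite !subr0 mulr0.
Qed.

Lemma killing_products z z' : (z <= derived n)%MS -> (z' <= derived n)%MS ->
  (forall d, (d <= derived n)%MS -> a z d z' = 0) ->
  2 *: (J z *m S z') = S z' *m J z + J z' *m S z.
Proof.
move=> zD z'D zdz'; apply: form_inj => x y.
have JT : (J z *m y^T) = - (y *m J z)^T by rewrite trmx_mul J_skew mulNmx opprK.
have -> : x *m (2 *: (J z *m S z')) *m y^T = 2 *: (x *m J z *m S z' *m y^T).
  by rewrite -scalemxAr -scalemxAl mulmxA.
have -> : x *m (S z' *m J z + J z' *m S z) *m y^T
    = - (x *m S z' *m (y *m J z)^T) + x *m J z' *m S z *m y^T.
  by rewrite mulmxDr mulmxDl -!mulmxA JT !mulmxN.
rewrite [LHS]mxE [RHS]mxE [X in _ = X + _]mxE !killingS.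
have := killing3_polar nabK (x *m E) z (y *m E) z'.
rewrite (nab_Ez _ zD) !(nab_zE _ zD) (nab_zz zD z'D) nab_EE (nab_Ez _ z'D).
rewrite !(alt3Z1 altA, alt3Z2 altA, alt3Z3 altA) (alt3_03 altA).
rewrite zdz' ?br_sub_derived // (alt3_swap13 altA z) .
lra.
Qed.

Definition mixed_vector : 'rV[R]_q := \row_k a (delta_mx 0 k *m E) z1 z2.
Local Notation xi := mixed_vector.

Lemma mixed_vectorE x : row_dot x xi = a (x *m E) z1 z2.
Proof.
have f_lin : linear (fun x => a (x *m E) z1 z2 : R).
  by move=> c w w'; rewrite mulmxDl -scalemxAl (alt3P1 altA).
by rewrite row_dotC; exact: (row_dot_riesz (linear_of f_lin)).
Qed.

Lemma mixed_vector_J z z' : (z <= derived n)%MS -> (z' <= derived n)%MS ->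
  (forall x, a z (x *m E) z' = row_dot x xi \/ a z (x *m E) z' = - row_dot x xi) ->
  xi *m J z = 0.
Proof.
move=> zD z'D mixed.
have H x : row_dot (x *m J z) xi = 0.
  have := proj2 nabK z (x *m E) z'.
  rewrite !(nab_zE _ zD) (nab_zz zD zD) (nab_zz zD z'D) (alt3_01 altA) (alt3_03 altA) (alt3Z2 altA) add0r addr0 => /eqP.
  rewrite mulf_eq0 oppr_eq0 invr_eq0 pnatr_eq0 /= => /eqP.
  by case: (mixed (x *m J z)) => -> // /eqP; rewrite oppr_eq0 => /eqP.
have := H (xi *m J z).
have dE (r s : 'rV[R]_q) : row_dot r s = (r *m s^T) 0 0.
  by rewrite mxE; apply: eq_bigr => k _; rewrite mxE.
rewrite dE => H0.
apply: (dot_eq0 (ip := std_dot R q)).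
rewrite -[LHS]/(row_dot (xi *m J z) (xi *m J z)) dE trmx_mul J_skew mulNmx mulmxN.
by rewrite mulmxA [LHS]mxE H0 oppr0.
Qed.

Lemma killing_EEJ1 x y : a (x *m E) (y *m E) (x *m J z1 *m E)
  = - ((x *m J z2 *m y^T) 0 0 * row_dot x xi).
Proof.
have := proj2 nabK (x *m E) (y *m E) z1.
rewrite !nab_EE (nab_Ez _ z1D) lie_alt scaler0 (alt3_01 altA) add0r.
rewrite br_rank_two !(alt3Z2 altA, alt3Z3 altA, alt3D2 altA) (alt3_eq23 altA) mulr0 add0r.
rewrite mixed_vectorE (alt3_swap23 altA _ z2); lra.
Qed.

Lemma killing_J1 : S z1 = 0 -> S z2 = 0 -> xi = 0 -> forall x y w,
  a (x *m J z1 *m E) (y *m E) (w *m E)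
  + 2^-1 * a (x *m E) (y *m J z1 *m E) (w *m E)
  + 2^-1 * a (x *m E) (y *m E) (w *m J z1 *m E) = 0.
Proof.
move=> S1 S2 xi0 x y w.
have m0 r : a (r *m E) z1 z2 = 0.
  by rewrite -mixed_vectorE xi0; exact: (dot0r (std_dot R q)).
have zbr u v r : a z1 (lie_br n u v) (r *m E) = 0.
  rewrite [lie_br n u v]derivedE ?br_sub_derived // (alt3D2 altA) !(alt3Z2 altA).
  by rewrite (alt3_eq12 altA) -(alt3_rot altA (r *m E)) m0 !mulr0 addr0.
have := killing3_polar nabK (x *m E) z1 (y *m E) (w *m E).
rewrite (nab_Ez _ z1D) !(nab_zE _ z1D) !nab_EE !(alt3Z1 altA, alt3Z2 altA, alt3Z3 altA) zbr.
rewrite (alt3_swap23 altA z1) zbr; lra.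
Qed.

(** Arguments are moved into the complement of the plane one at a time. *)
Lemma killing_eq0 : S z1 = 0 -> S z2 = 0 -> xi = 0 ->
  (forall x y w, a (x *m E) (y *m E) (w *m E) = 0) -> forall u v z, a u v z = 0.
Proof.
move=> S1 S2 xi0 b0.
have m0 x : a (x *m E) z1 z2 = 0.
  by rewrite -mixed_vectorE xi0; exact: (dot0r (std_dot R q)).
have s1 x y : a (x *m E) (y *m E) z1 = 0 by rewrite -killingS S1 mulmx0 mul0mx mxE.
have s2 x y : a (x *m E) (y *m E) z2 = 0 by rewrite -killingS S2 mulmx0 mul0mx mxE.
have A1 x y v : a (x *m E) (y *m E) v = 0.
  have [w ->] := span v.
  by rewrite !(alt3D3 altA) !(alt3Z3 altA) b0 s1 s2 !mulr0 !addr0.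
have A2 x v : a (x *m E) z1 v = 0 /\ a (x *m E) z2 v = 0.
  have [w ->] := span v; rewrite !(alt3D3 altA) !(alt3Z3 altA) !(alt3_eq23 altA).
  rewrite m0 !(alt3_swap23 altA _ _ (w *m E)) s1 s2 (alt3_swap23 altA _ z2 z1) m0.
  by rewrite !(oppr0, mulr0, addr0).
have A3 x u v : a (x *m E) u v = 0.
  have [w ->] := span u; rewrite !(alt3D2 altA) !(alt3Z2 altA) A1 (A2 x v).1 (A2 x v).2.
  by rewrite !mulr0 !addr0.
have A4 v : a z1 z2 v = 0.
  have [w ->] := span v; rewrite !(alt3D3 altA) !(alt3Z3 altA).
  by rewrite (alt3_eq13 altA) (alt3_eq23 altA) -(alt3_rot altA (w *m E)) A3 !mulr0 !addr0.
have A5 u v : a z1 u v = 0 /\ a z2 u v = 0.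
  have [w ->] := span u; rewrite !(alt3D2 altA) !(alt3Z2 altA) !(alt3_eq12 altA) A4.
  rewrite (alt3_swap12 altA z2 z1) A4 !(alt3_swap12 altA _ (w *m E)) !A3.
  by rewrite !(oppr0, mulr0, addr0).
move=> u v z; have [x ->] := span u; rewrite !(alt3D1 altA) !(alt3Z1 altA) A3.
by rewrite (A5 v z).1 (A5 v z).2 !mulr0 !addr0.
Qed.

End KillingRankTwo.

(** A non-zero form has a non-zero component with an argument in the derived
    plane, and each such component yields the splitting. *)
Lemma lie_iso_of_killing_rank_two (R : realType) (n : lie_algebra R)
    (ip : {dot 'rV[R]_(lie_dim n) for idfun}) :
  two_step_nilpotent n -> ~ derived_line n -> (lie_dim n <= 6)%N ->
  \rank (derived n) = 2 -> has_killing3 ip ->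
  lie_iso n (lie_dsum (heisenberg R 1) (heisenberg R 1)).
Proof.
move=> n2 nline p6 D2 [nab [a [nabLC nabK [u0 [v0 [w0 nz]]]]]].
have [q [E [z1 [z2 [qp EE [z1D z2D DE] Ez span]]]]] := adapted_basis ip D2.
have altA := proj1 nabK.
pose b x y w := a (x *m E) (y *m E) (w *m E).
have altb : alternating3 b.
  split=> [y w c x x'|x y w|x w]; rewrite /b.
  - by rewrite mulmxDl -scalemxAl (alt3P1 altA).
  - exact: alt3_rot altA _ _ _.
  - exact: alt3_eq12 altA _ _.
pose J z := gram_mx (br_form ip E z); pose S z := gram_mx (killing_pairing a E z).
pose xi := mixed_vector a E z1 z2.
have span' v : exists x s t, v = x *m E + (s *: z1 + t *: z2).
  by have [x ->] := span v; exists x, (ip v z1), (ip v z2).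
have dz (z z' : 'rV_(lie_dim n)) : (z = z1 \/ z = z2) -> (z' = z1 \/ z' = z2) ->
    forall d, (d <= derived n)%MS -> a z d z' = 0.
  move=> zz zz' d /DE ->; rewrite (alt3D2 altA) !(alt3Z2 altA).
  by case: zz zz' => -> [] ->; rewrite ?(alt3_eq12 altA) ?(alt3_eq23 altA)
    ?(alt3_eq13 altA) !mulr0 addr0.
have prod z z' : (z = z1 \/ z = z2) -> (z' = z1 \/ z' = z2) ->
    2 *: (J z *m S z') = S z' *m J z + J z' *m S z.
  move=> zz zz'; apply: (killing_products n2 nabLC nabK EE z1D z2D DE Ez span).
  - by case: zz => ->.
  - by case: zz' => ->.
  - exact: dz.
have comm z : (z = z1 \/ z = z2) -> J z *m S z = S z *m J z.
  move=> zz; have := prod z z zz zz; move: (J z *m S z) (S z *m J z) => X Y XY.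
  by apply/matrixP => i j; move/matrixP/(_ i j): XY; rewrite !mxE; lra.
have xi1 : xi *m J z1 = 0.
  apply: (mixed_vector_J n2 nabLC nabK EE z1D z2D Ez span (z' := z2)) => // x.
  by right; rewrite (mixed_vectorE nabK) (alt3_swap12 altA).
have xi2 : xi *m J z2 = 0.
  apply: (mixed_vector_J n2 nabLC nabK EE z1D z2D Ez span (z' := z1)) => // x.
  by left; rewrite (mixed_vectorE nabK) (alt3_rot altA).
have q4 : (q <= 4)%N by lia.
have Jskew z : (J z)^T = - J z by exact: J_skew.
have Sskew z : (S z)^T = - S z by exact: (S_skew nabK).
have brE := br_rank_two E DE.
have bJ1 x y : b x y (x *m J z1) = - ((x *m J z2 *m y^T) 0 0 * row_dot x xi).
  exact: (killing_EEJ1 n2 nabLC nabK EE z1D z2D DE Ez span).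
have bJ1k : S z1 = 0 -> S z2 = 0 -> xi = 0 -> forall x y w,
    b (x *m J z1) y w + 2^-1 * b x (y *m J z1) w + 2^-1 * b x y (w *m J z1) = 0.
  exact: (killing_J1 n2 nabLC nabK EE z1D z2D DE Ez span).
have c1 := comm z1 (or_introl erefl); have c2 := comm z2 (or_intror erefl).
have c12 := prod z1 z2 (or_introl erefl) (or_intror erefl).
have c21 := prod z2 z1 (or_intror erefl) (or_introl erefl).
have [S10|S1n0] := eqVneq (S z1) 0; last first.
  exact: (split_of_S1 n2 nline z1D z2D span' q4 (Jskew z1) (Jskew z2) brE
    (Sskew z1) (Sskew z2) c1 c12 c21 S1n0).
have [S20|S2n0] := eqVneq (S z2) 0; last first.
  exact: (split_of_S2 n2 nline z1D z2D span' q4 (Jskew z1) (Jskew z2) brE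
    (Sskew z1) (Sskew z2) c2 c12 c21 S10 S2n0).
have [xi0|xin0] := eqVneq xi 0; last first.
  exact: (split_of_xi n2 nline z1D z2D span' q4 (Jskew z1) (Jskew z2) brE
    altb xi1 xi2 bJ1 xin0).
case/eqP: nz; apply: (killing_eq0 nabK span S10 S20 xi0).
exact: (horizontal_form_eq0 n2 nline z1D z2D span' q4 (Jskew z1) brE altb bJ1 bJ1k
  S10 S20 xi0).
Qed.

(** * The classification *)

Lemma lie_iso_abelian0_sum (R : realType) (n : lie_algebra R) :
  lie_iso (lie_dsum (abelian R 0) n) n.
Proof.
have f_lin : linear (fun u : 'rV[R]_(0 + lie_dim n) => rsubmx u).
  by move=> c u v; rewrite !linearP.
exists (linear_of f_lin); split=> [|x y] /=; last by rewrite /dsum_br row_mxKr.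
exists (row_mx 0) => x /=; last by rewrite row_mxKr.
by rewrite -[RHS]hsubmxK; congr row_mx; apply/rowP => -[].
Qed.

Theorem theorem5p14 (R : realType) :
  let classes : 8.-tuple (lie_algebra R) :=
    [tuple heisenberg R 1;
           lie_dsum (abelian R 1) (heisenberg R 1);
           lie_dsum (abelian R 2) (heisenberg R 1);
           heisenberg R 2;
           lie_dsum (abelian R 3) (heisenberg R 1);
           lie_dsum (heisenberg R 1) (heisenberg R 1);
           lie_dsum (abelian R 1) (heisenberg R 2);
           free_two_step_3 R] in
  [/\ map (@lie_dim R) classes = [:: 3; 4; 5; 5; 6; 6; 6; 6]%N,
      forall i j : 'I_8, lie_iso (tnth classes i) (tnth classes j) -> i = j
    & forall n : lie_algebra R,
        [/\ two_step_nilpotent n, (lie_dim n <= 6)%N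
          & exists ip : {dot 'rV[R]_(lie_dim n) for idfun},
              @carries_left_invariant_killing_form R n 3 ip]
        <-> exists i : 'I_8, lie_iso n (tnth classes i)].
Proof.
move=> classes.
have classE i : tnth classes i = nth (abelian R 0) classes i by exact: tnth_nth.
have h1 := heisenberg_derived_line R 1; have h2 := heisenberg_derived_line R 2.
have [e [f ef]] := heisenberg1_unit_bracket R.
have d1 := @heisenberg1_decomposable R.
have d2 := @heisenberg2_not_decomposable R.
have asum k m := @abelian_sum_decomposable R k m.
split=> // [i j ij|n].
- have dimE := lie_iso_dim ij.
  (* The values of the two invariants on the eight models, in order. *)
  pose line := [:: true; true; true; true; true; false; true; false].
  pose decomp := [:: true; true; true; false; true; false; false; true].
  have lineP k : derived_line (tnth classes k) <-> nth false line k.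
    rewrite classE; case: k => [[|[|[|[|[|[|[|[|]]]]]]]] k8] //=; split=> // H;
      try by [exact: h1 | exact: h2 | exact: abelian_sum_derived_line].
    - by case: (lie_dsum_not_derived_line ef ef).
    - by case: (@free_two_step_3_not_derived_line R).
  have decompP k : decomposable_bracket (tnth classes k) <-> nth false decomp k.
    rewrite classE; case: k => [[|[|[|[|[|[|[|[|]]]]]]]] k8] //=; split=> // H;
      try by [exact: d1 | exact: (proj1 (asum _ _)) | exact: free_two_step_3_decomposable].
    - by case: (lie_dsum_not_decomposable ef ef).
    - by case: d2; exact: (proj2 (asum 1%N _)).
  have lineE : nth false line i = nth false line j.
    by apply/idP/idP => /lineP H; apply/lineP; apply: derived_line_iso H;
      [exact: lie_iso_sym|].
  have decompE : nth false decomp i = nth false decomp j.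
    by apply/idP/idP => /decompP H; apply/decompP; apply: decomposable_bracket_iso H;
      [exact: lie_iso_sym|].
  move: dimE lineE decompE; rewrite !classE => dimE lineE decompE; apply: val_inj => /=.
  move: dimE lineE decompE.
  case: i {ij} => [[|[|[|[|[|[|[|[|]]]]]]]] i8] //;
  by case: j => [[|[|[|[|[|[|[|[|]]]]]]]] j8].
split=> [[n2 p6 [ip /left_invariant_killing_algebra nK]]|[i ni]].
  have class_iso i : lie_iso n (nth (abelian R 0) classes i) -> (i < 8)%N ->
      exists i : 'I_8, lie_iso n (tnth classes i).
    by move=> ni i8; exists (Ordinal i8); rewrite classE.
  have [line|nline] := pselect (derived_line n).
    have [k [l [l0 iso]]] := lie_iso_heisenberg_sum n2 line.
    have dimE : (lie_dim n = k + (l + l + 1))%N := lie_iso_dim iso.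
    case: l l0 iso dimE => [|[|[|l]]] // _ iso dimE; last by exfalso; lia.
      case: k iso dimE => [|[|[|[|k]]]] iso dimE; last by exfalso; lia.
      - by apply: (class_iso 0%N) => //; exact: lie_iso_trans iso (lie_iso_abelian0_sum _).
      - exact: (class_iso 1%N).
      - exact: (class_iso 2%N).
      - exact: (class_iso 4%N).
    case: k iso dimE => [|[|k]] iso dimE; last by exfalso; lia.
    - by apply: (class_iso 3%N) => //; exact: lie_iso_trans iso (lie_iso_abelian0_sum _).
    - exact: (class_iso 6%N).
  have [D3|D2] := leqP 3 (\rank (derived n)).
    by apply: (class_iso 7%N) => //; exact: lie_iso_free_two_step_3.
  apply: (class_iso 5%N) => //; apply: lie_iso_of_killing_rank_two nK => //.
  apply/eqP; rewrite eqn_leq -ltnS D2 /= ltnNge; apply/negP => /derived_line_of_rank.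
  exact: nline.
have [m2 mK] : two_step_nilpotent (tnth classes i) /\ standard_killing3 (tnth classes i).
  have hK l : (0 < l)%N -> two_step_nilpotent (heisenberg R l) /\
      standard_killing3 (heisenberg R l).
    by move=> l0; split; [exact: heisenberg_two_step | exact: heisenberg_killing3].
  have sK (m m' : lie_algebra R) : (forall x y z, lie_br m (lie_br m x y) z = 0) ->
      two_step_nilpotent m' /\ standard_killing3 m' ->
      two_step_nilpotent (lie_dsum m m') /\ standard_killing3 (lie_dsum m m').
    by move=> mm [m'2 m'K]; split; [exact: lie_dsum_two_step | exact: lie_dsum_killing3].
  rewrite classE; case: i {ni} => [[|[|[|[|[|[|[|[|]]]]]]]] i8] //=;
    try by [exact: hK | apply: sK => //; exact: hK].
  - by apply: sK; [exact: (proj2 (heisenberg_two_step R _)) | exact: hK].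
  - by split; [exact: free_two_step_3_two_step | exact: free_two_step_3_killing3].
have n2 := lie_iso_two_step ni m2; split=> //.
  by rewrite (lie_iso_dim ni) classE; case: i {ni m2 mK} => [[|[|[|[|[|[|[|[|]]]]]]]] i8].
have [ip ipK] := killing3_transport ni mK; exists ip.
exact: killing_algebra_left_invariant.
Qed.
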